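(* Let $C \subseteq \mathbb{R}^k$ be a convex body and let $C^o$ be its polar. Let $d$ be the smallest degree of a nonzero polynomial with real coefficients that vanishes on the boundary of $C^o$. Then $\operatorname{rank}_{\mathrm{psd}}(C) \geq \sqrt{\log d}$.
   Context: A convex body in $\mathbb{R}^k$ is a closed convex set $C\subseteq\mathbb{R}^k$ such that the origin lies in the interior of $C$ (boundedness is not required). Its polar is $C^o = \{ c \in \mathbb{R}^k : \langle c,x \rangle \leq 1 \ \forall x \in C\}$. The boundary of a set $D$ is $\partial D = \mathrm{cl}(D)\setminus \mathrm{int}(D)$. $\log$ denotes the logarithm in base 2. A spectrahedron defined using $m\times m$ matrices is a set of the form $S = \{ x \in \mathbb{R}^n : A_0 + x_1 A_1 + \dots + x_n A_n \succeq 0\}$, where $A_0,\dots,A_n$ are real symmetric $m\times m$ matrices and $M\succeq 0$ means $M$ is positive semidefinite. A convex set $C\subseteq\mathbb{R}^k$ has a semidefinite lift of size $m$ if $C=\pi(S)$ for some spectrahedron $S\subseteq \mathbb{R}^n$ (some $n$) defined using $m\times m$ matrices and some linear map $\pi:\mathbb{R}^n\to\mathbb{R}^k$. The positive semidefinite rank $\operatorname{rank}_{\mathrm{psd}}(C)$ is the smallest $m$ such that $C$ has a semidefinite lift of size $m$ ($+\infty$ if there is none). *)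

(* Defs.v *)
From HB Require Import structures.
From mathcomp Require Import all_boot all_order all_algebra.
From mathcomp Require Import all_classical all_reals all_analysis.
(* The notations of mpoly clash with those of the analysis library. *)
From mathcomp Require Import -(notations) mpoly.
Set Implicit Arguments.
Unset Strict Implicit.
Unset Printing Implicit Defensive.
Import Order.TTheory GRing.Theory Num.Theory.
Import numFieldNormedType.Exports.
Local Open Scope classical_set_scope.
Local Open Scope ring_scope.

(* R^k is the space of row vectors 'rV[R]_k with its library topology. *)

(* "Convex body" here does not include boundedness. *)
Definition convex_body (R : realType) (k : nat) (C : set 'rV[R]_k) : Prop :=
  [/\ convex_set (C : set (convex_lmodType 'rV[R]_k)),
      closed C & interior C 0].

Definition polar (R : realType) (k : nat) (C : set 'rV[R]_k) : set 'rV[R]_k :=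
  [set c | forall x, C x -> (c *m x^T) 0 0 <= 1].

Definition boundary (T : topologicalType) (D : set T) : set T :=
  closure D `\` interior D.

(* The least element of a set of natural numbers, +oo for the empty set. *)
Definition least (R : realType) (S : set nat) : \bar R :=
  ereal_inf [set (n%:R)%:E | n in S].

Lemma least_set0 (R : realType) : least R set0 = +oo%E.
Proof. by rewrite /least image_set0 ereal_inf0. Qed.

Lemma least_eq (R : realType) (S : set nat) (n : nat) :
  S n -> (forall m, S m -> (n <= m)%N) -> least R S = (n%:R)%:E.
Proof.
move=> Sn minn; apply/eqP; rewrite eq_le; apply/andP; split.
  by apply: ereal_inf_lbound; exists n.
by apply: le_ereal_inf_tmp => _ [m Sm <-]; rewrite lee_fin ler_nat minn.
Qed.

Definition vanishes_on (R : realType) (k : nat) (p : mpoly.mpoly k R)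
    (D : set 'rV[R]_k) : Prop :=
  forall c, D c -> mpoly.meval (fun i => c 0 i) p = 0.

(* For nonzero p, mpoly.msize p is the total degree of p plus one. *)
Definition min_vanishing_degree (R : realType) (k : nat) (D : set 'rV[R]_k) :
    \bar R :=
  least R [set d : nat | exists p : mpoly.mpoly k R,
                     [/\ p != 0, vanishes_on p D & d = (mpoly.msize p).-1]].

Definition psd (R : realType) (m : nat) (M : 'M[R]_m) : Prop :=
  M \is symmetricmx /\ forall u : 'rV[R]_m, 0 <= (u *m M *m u^T) 0 0.

Definition spectrahedron (R : realType) (m n : nat)
    (A0 : 'M[R]_m) (A : 'I_n -> 'M[R]_m) : set 'rV[R]_n :=
  [set x | psd (A0 + \sum_(i < n) x 0 i *: A i)].

Definition has_sdp_lift (R : realType) (k : nat) (C : set 'rV[R]_k) (m : nat) :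
    Prop :=
  exists (n : nat) (A0 : 'M[R]_m) (A : 'I_n -> 'M[R]_m)
         (pi : {linear 'rV[R]_n -> 'rV[R]_k}),
    [/\ A0 \is symmetricmx, forall i, A i \is symmetricmx
      & C = pi @` spectrahedron A0 A].

Definition psd_rank (R : realType) (k : nat) (C : set 'rV[R]_k) : \bar R :=
  least R [set m | has_sdp_lift C m].

(* Base-2 logarithm on [0, +oo], with log2 0 = -oo and log2 +oo = +oo. *)
Definition log2 (R : realType) (x : \bar R) : \bar R :=
  (lne x * ((ln 2)^-1)%:E)%E.

(* Main.v *)
(* Write C = pi(S) with S = {y : A(y) psd}.  A boundary point c of the polar is
   characterized by an affine functional (t, y) |-> t - <c, pi y> that is
   nonnegative but not uniformly positive on the psd matrices of the linear
   family t A_0 + sum y_i A_i, or on those with t = 0.  So it suffices to find,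
   for a linear family of m x m symmetric matrices carrying affine functionals
   of c, a nonzero polynomial of degree at most 2^(m^2 - 1) vanishing at every
   such c; the polynomials of the two families are then multiplied.

   After facial reductions of the family, a strictly positive functional zeta
   has a central point (maximize the determinant on a slice): a positive definite
   X in the family with tr X = 1 and a matrix Z with XZ = s I representing zeta,
   and s tends to 0 when zeta tends to a tight functional.  Dimension counting
   for bihomogeneous polynomials in (X, Z) gives a polynomial relation
   P(zeta(Z), XZ + ZX) = 0 on tr X = 1 of degree at most 2^(m^2 - 1).  To keep it
   nonzero when XZ + ZX is specialized to 2 s I and zeta to the given affine
   functionals, add generic perturbations of sizes q << r << s and keep the lowest
   coefficient in q, then r, then s.  This coefficient is a polynomial in c that
   vanishes at the limit. *)

Require Import Defs.
From mathcomp Require Import all_boot all_order all_algebra.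
From mathcomp Require Import all_classical all_reals all_analysis.
From mathcomp Require Import -(notations) mpoly.
From mathcomp Require Import zify ring lra.
From Stdlib Require NArith.
Import numFieldNormedType.Exports.
Set Implicit Arguments.
Unset Strict Implicit.
Unset Printing Implicit Defensive.
Import Order.TTheory GRing.Theory Num.Theory.

(** * Counting monomials *)

(** Only the degree of [P] in the variables standing for [zeta] matters, because the symmetrized
    product is specialized to values free of [c]. With [D = 2 E], the monomials of degree [D] whose
    degree in the product is at most [E] outnumber the target space of bidegree [(E, D)] once [E]
    reaches [(p + 1) 2 ^ p], where [p + 1 = m (m + 1) / 2]; for large [m] this is far below
    [2 ^ (m ^ 2)]. The product is symmetrized so that it has exactly as many coordinates as [Z] and
    [Z |-> X Z + Z X] is invertible for positive definite [X]: every perturbation of its value is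
    realized by moving [Z]. Families are relations and not functions, since a compression during
    facial reduction can identify matrices that carry different functionals. There are two families
    because [t >= 0] is not a condition on an [m x m] matrix, and one more diagonal block would
    raise the size to [m + 1]. *)

(* ['C(d + n, d)] is the number of monomials of degree [d] in [n.+1] variables. *)
Definition nmon (n d : nat) : nat := 'C(d + n, d).

Lemma nmonE n d : nmon n d = 'C(d + n, n).
Proof. by rewrite /nmon -[in RHS]bin_sub ?leq_addl // addnK. Qed.

Lemma leq_nmon n d e : d <= e -> nmon n d <= nmon n e.
Proof. by move=> de; rewrite !nmonE leq_bin2l // leq_add2r. Qed.

Lemma nmonS n d : n.+1 * nmon n.+1 d = (d + n.+1) * nmon n d.
Proof. by rewrite !nmonE addnS -mul_bin_diag. Qed.

Lemma sum_nmon n E : \sum_(b < E.+1) nmon n b = nmon n.+1 E.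
Proof.
elim: E => [|E IH]; first by rewrite big_ord1 /nmon !bin0.
by rewrite big_ord_recr /= IH !nmonE [in RHS]addSn binS addSnnS.
Qed.

(** The quotient of the two binomials is a product of [p] factors [(2E + i) / (E + i)], each at most
    2. *)
Lemma nmon_double p E : nmon p E.*2 <= 2 ^ p * nmon p E.
Proof.
elim: p => [|p IH]; first by rewrite !nmonE !bin0.
rewrite -(leq_pmul2l (ltn0Sn p)) nmonS mulnCA nmonS expnS -mulnACA.
by rewrite leq_mul // mulnDr mul2n leq_add2l leq_pmull.
Qed.

Lemma nmon_gt0 n d : 0 < nmon n d.
Proof. by rewrite nmonE bin_gt0 leq_addl. Qed.

(** Since [b <= E], every first factor is at least [nmon n E], and the second factors add up to
    [nmon p.+1 E]. The latter is [(E + p + 1) / (p + 1)] times [nmon p E], which beats the loss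
    [2 ^ p] from doubling. *)
Lemma count_large n p E : p.+1 * 2 ^ p <= E ->
  nmon n E * nmon p E.*2 < \sum_(b < E.+1) nmon n (E.*2 - b) * nmon p b.
Proof.
move=> leE; apply: (@leq_trans (nmon n E * nmon p.+1 E)).
  rewrite ltn_pmul2l ?nmon_gt0 // -(ltn_pmul2l (ltn0Sn p)) nmonS.
  apply: (@leq_ltn_trans (E * nmon p E)).
    apply: (@leq_trans (p.+1 * (2 ^ p * nmon p E))).
      by rewrite leq_pmul2l // nmon_double.
    by rewrite mulnA leq_mul.
  by rewrite ltn_pmul2r ?nmon_gt0 // addnS ltnS leq_addr.
rewrite -sum_nmon big_distrr; apply: leq_sum => b _; apply: leq_mul => //=.
by apply: leq_nmon; rewrite -addnn -addnBA ?leq_addr // -ltnS.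
Qed.

Section BinaryCount.
Import NArith.

(* Binary versions of the sides of the counting inequality, both multiplied by
   [n`! * p`!]. *)
Fixpoint risN (n : nat) (d : N) : N :=
  if n is n'.+1 then N.mul (N.add d (N.of_nat n)) (risN n' d) else N.one.

Fixpoint sumN (n p D b : nat) : N :=
  let t := N.mul (risN n (N.of_nat (D - b))) (risN p (N.of_nat b)) in
  if b is b'.+1 then N.add (sumN n p D b') t else t.

Definition countN (n p D E : nat) : bool :=
  N.ltb (N.mul (risN n (N.of_nat E)) (risN p (N.of_nat D))) (sumN n p D E).

Lemma risNE n d : N.to_nat (risN n (N.of_nat d)) = n`! * nmon n d.
Proof.
elim: n => [|n IH]; first by rewrite nmonE bin0.
rewrite [risN _ _]/= -/(N.of_nat n.+1) N2Nat.inj_mul IH N2Nat.inj_add !Nat2N.id.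
by rewrite multE plusE factS mulnAC nmonS mulnAC mulnA.
Qed.

Lemma sumNE n p D E : N.to_nat (sumN n p D E) =
  n`! * p`! * \sum_(b < E.+1) nmon n (D - b) * nmon p b.
Proof.
elim: E => [|E IH].
  rewrite [sumN _ _ _ _]/= big_ord1 N2Nat.inj_mul.
  by rewrite (risNE _ 0) !risNE multE mulnACA.
rewrite [sumN _ _ _ _]/= -/(N.of_nat E.+1) N2Nat.inj_add IH N2Nat.inj_mul !risNE.
by rewrite [in RHS]big_ord_recr /= mulnDr multE plusE [n`! * _ * (_ * _)]mulnACA.
Qed.

Lemma countNP n p D E : countN n p D E ->
  nmon n E * nmon p D < \sum_(b < E.+1) nmon n (D - b) * nmon p b.
Proof.
move=> /N.ltb_lt; rewrite /N.lt N2Nat.inj_compare.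
rewrite N2Nat.inj_mul sumNE !risNE multE mulnACA => /PeanoNat.Nat.compare_lt_iff/ssrnat.ltP.
by rewrite ltn_pmul2l ?muln_gt0 ?fact_gt0.
Qed.

End BinaryCount.

(* The exponent in [D] is a truncated subtraction: [D = 1] for [m = 0]. *)
Definition elimdeg (m : nat) : nat := 2 ^ (m ^ 2).-1.

Lemma bin2_leq_pow2 m : 'C(m.+3, 2) <= 2 ^ m.+2.
Proof.
elim: m => // m IH.
rewrite binS bin1 expnS mul2n -addnn leq_add //.
apply: leq_trans (ltn_expl _ _) => //.
Qed.

(** Here [p] is about [m ^ 2 / 2], and [p.+1 <= 2 ^ m]. What remains is [m + p <= m ^ 2 - 2], which
    first holds at [m = 4]. *)
Lemma large_degree m p : 3 < m -> p.+1 = 'C(m.+1, 2) ->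
  p.+1 * 2 ^ p <= 2 ^ (m ^ 2).-2.
Proof.
move=> m3 hp; apply: (@leq_trans (2 ^ (m + p))).
  rewrite expnD leq_mul // hp.
  by case: m m3 {hp} => [|[|m]] // _; exact: bin2_leq_pow2.
have hp2 : p.+1.*2 = m * m.+1 by rewrite -mul2n hp -mul_bin_diag bin1 mulnC.
have m2 : 4 * m <= m ^ 2 by rewrite -mulnn leq_mul2r m3 orbT.
have m16 : 4 * 4 <= m ^ 2 by rewrite (leq_trans _ m2) // leq_mul2l.
have e : m * m.+1 = m ^ 2 + m by rewrite mulnS mulnn addnC.
rewrite leq_pexp2l //; lia.
Qed.

Lemma monomial_count_large m n p : 3 < m -> p.+1 = 'C(m.+1, 2) ->
  exists2 E, E <= elimdeg m &
    nmon n E * nmon p (elimdeg m) <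
      \sum_(b < E.+1) nmon n (elimdeg m - b) * nmon p b.
Proof.
move=> m3 hp; have m1 : 1 < (m ^ 2).
  by rewrite (leq_trans (ltnW (ltnW m3))) // -mulnn leq_pmulr // (leq_trans _ m3).
have -> : elimdeg m = (2 ^ (m ^ 2).-2).*2.
  by rewrite -mul2n -expnS prednK // -ltnS prednK // ltnW.
exists (2 ^ (m ^ 2).-2); first by rewrite -addnn leq_addr.
exact/count_large/large_degree.
Qed.

(* [count_large] is too weak for [m <= 3]; there the values of [E] were found by
   a numerical search. *)
Lemma monomial_count m n p : p.+1 = 'C(m.+1, 2) -> n <= p ->
  exists2 E, E <= elimdeg m &
    nmon n E * nmon p (elimdeg m) <
      \sum_(b < E.+1) nmon n (elimdeg m - b) * nmon p b.
Proof.
have [m3 hp _|] := ltnP 3 m; first exact: monomial_count_large.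
have [D hD] : {D | D = elimdeg m} by exists (elimdeg m).
rewrite -hD.
have H E : E <= D -> countN n p D E -> exists2 E, E <= D &
    nmon n E * nmon p D < \sum_(b < E.+1) nmon n (D - b) * nmon p b.
  by move=> ED /countNP h; exists E.
case: m hD => [|[|[|[|m]]]] // hD _ ; case=> ep.
- subst p; case: n H => [|n] // H _.
  by apply: (H 1); rewrite hD; vm_compute; reflexivity.
- subst p; case: n H => [|[|[|n]]] // H _;
    [apply: (H 5) | apply: (H 5) | apply: (H 1)];
    by rewrite hD; vm_compute; reflexivity.
- subst p; case: n H => [|[|[|[|[|[|n]]]]]] // H _;
    [apply: (H 200) | apply: (H 200) | apply: (H 170) | apply: (H 150)
    | apply: (H 80) | apply: (H 50)];
    by rewrite hD; vm_compute; reflexivity.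
Qed.

(** * Polynomial relations between bilinear functions *)

Local Open Scope ring_scope.
#[local] Opaque meval.

Section Nonvanishing.

Lemma base_expansion_inj n K (a b : 'I_n -> nat) :
  (forall i, a i < K)%N -> (forall i, b i < K)%N ->
  (\sum_i a i * K ^ i = \sum_i b i * K ^ i)%N -> a =1 b.
Proof.
elim: n a b => [|n IH] a b ha hb; first by move=> _ [].
rewrite !big_ord_recl !muln1 => e.
have K0 : (0 < K)%N by apply: leq_ltn_trans (ha ord0).
have shift (c : 'I_n.+1 -> nat) :
    (\sum_(i < n) c (lift ord0 i) * K ^ (lift ord0 i) =
     K * \sum_(i < n) c (lift ord0 i) * K ^ i)%N.
  by rewrite big_distrr; apply: eq_bigr => i _ /=; rewrite expnS mulnCA.
move: e; rewrite !shift => e.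
have e0 : a ord0 = b ord0.
  have := congr1 (modn^~ K) e; rewrite /= ![(K * _)%N]mulnC.
  by rewrite ![(_ + _ * K)%N]addnC !modnMDl !modn_small.
move: e; rewrite e0 => /addnI/eqP; rewrite eqn_pmul2l // => /eqP e i.
case: (unliftP ord0 i) => [j|] -> //.
exact: (IH (a \o lift ord0) (b \o lift ord0) (fun k => ha _) (fun k => hb _) e).
Qed.

Lemma poly_nonroot (R : numDomainType) (p : {poly R}) :
  p != 0 -> exists t, p.[t] != 0.
Proof.
move=> p0; apply: contrapT => h.
pose rs : seq R := [seq i%:R | i <- iota 0 (size p)].
have := @max_poly_roots _ p rs p0.
rewrite size_map size_iota ltnn => H; suff: false by []; apply: H.
  by apply/allP => t _; apply: contra_notT h => ht; exists t.
by rewrite map_inj_uniq ?iota_uniq // => i j /eqP; rewrite eqr_nat => /eqP.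
Qed.

(* Kronecker substitution: the exponents below [K] are digits in base [K]. *)
Lemma mpoly_nonroot (R : numDomainType) n (p : mpoly n R) :
  p != 0 -> exists v, meval v p != 0.
Proof.
move=> p0; pose K := msize p.
pose e (m : multinom n) := (\sum_i m i * K ^ i)%N.
have ltK m : m \in msupp p -> forall i, (m i < K)%N.
  move=> /msize_mdeg_lt h i; apply: leq_ltn_trans h.
  by rewrite mdegE (bigD1 i) //= leq_addr.
pose q : {poly R} := \sum_(m <- msupp p) mcoeff m p *: 'X^(e m).
have [m0 m0p] : exists m0, m0 \in msupp p.
  by exists (mlead p); rewrite mlead_supp.
have q0 : q != 0.
  apply/eqP => /(congr1 (fun q : {poly R} => q`_(e m0))) /eqP.
  rewrite coef0 coef_sum (bigD1_seq m0) //= ?msupp_uniq //.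
  rewrite coefZ coefXn eqxx mulr1 big_seq_cond big1 ?addr0.
    by rewrite -[_ == _]negbK -mcoeff_msupp m0p.
  move=> m /andP[mp /eqP nm]; rewrite coefZ coefXn.
  case: eqP => [/base_expansion_inj h|]; last by rewrite mulr0.
  case: nm; apply/mnmP => i; apply/esym/h => // j; exact: ltK.
have [t qt] := poly_nonroot q0; exists (fun i => t ^+ (K ^ i)).
rewrite mevalE; move: qt; rewrite /q horner_sum.
rewrite (eq_bigr (fun m => mcoeff m p * \prod_(i < n) (t ^+ (K ^ i)) ^+ m i)) //.
move=> m _; rewrite hornerZ hornerXn; congr (_ * _).
by rewrite /e -prodrXr; apply: eq_bigr => i _; rewrite -exprM mulnC.
Qed.

End Nonvanishing.

Section Counting.
Local Open Scope nat_scope.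

Lemma card_mdeg n d K : d < K ->
  #|[pred a : bmultinom n.+1 K | mdeg a == d]| = nmon n d.
Proof.
move=> dK; rewrite /nmon -size_basis.
rewrite cardE -(size_map (@bmnm _ _)); apply/perm_size/uniq_perm.
- by rewrite map_inj_uniq ?enum_uniq //; exact: val_inj.
- exact: uniq_basis.
move=> m; rewrite -basis_cover; apply/mapP/idP => [[a]|/eqP md].
  by rewrite mem_enum inE => h ->.
have mK : mdeg m < K by rewrite md.
by exists (BMultinom mK) => //; rewrite mem_enum inE /= md.
Qed.

Lemma card_mdeg_pair n p d e K L : d < K -> e < L ->
  #|[pred ab : bmultinom n.+1 K * bmultinom p.+1 L |
      (mdeg ab.1 == d) && (mdeg ab.2 == e)]| = nmon n d * nmon p e.
Proof.
move=> dK eL; rewrite -(card_mdeg n dK) -(card_mdeg p eL) -cardX.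
by apply: eq_card => -[a b].
Qed.

Lemma card_mdeg_sum n p D E : E <= D ->
  #|[pred ab : bmultinom n.+1 D.+1 * bmultinom p.+1 D.+1 |
      (mdeg ab.1 + mdeg ab.2 == D) && (mdeg ab.2 <= E)]| =
  \sum_(b < E.+1) nmon n (D - b) * nmon p b.
Proof.
move=> ED; rewrite -sum1_card.
rewrite (partition_big (fun ab : bmultinom n.+1 D.+1 * bmultinom p.+1 D.+1 =>
  inord (mdeg ab.2) : 'I_E.+1) predT) //=.
apply: eq_bigr => b _; rewrite sum1_card -(@card_mdeg_pair n p (D - b) b D.+1 D.+1).
- apply: eq_card => -[a c]; rewrite !inE /=.
  have bE : b <= E by rewrite -ltnS.
  apply/andP/andP => [[/andP[/eqP h cE]]|[/eqP ha /eqP hc]].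
    move/eqP/(congr1 val) => /=.
    rewrite inordK // => <-; split=> //.
    by apply/eqP; rewrite -[mdeg a](addnK (mdeg c)) h.
  by rewrite inE /= ha hc inord_val eqxx subnK ?(leq_trans bE ED) ?eqxx.
- by rewrite ltnS leq_subr.
- by rewrite ltnS (leq_trans _ ED) // -ltnS.
Qed.

End Counting.

Section Evaluation.
Variables (A : comNzRingType) (n : nat) (v : 'I_n -> A).

Lemma meval_sum I (r : seq I) P (F : I -> mpoly n A) :
  meval v (\sum_(i <- r | P i) F i) = \sum_(i <- r | P i) meval v (F i).
Proof. exact: (big_morph (meval v) (mevalD v) (meval0 v)). Qed.

Lemma meval_prod I (r : seq I) P (F : I -> mpoly n A) :
  meval v (\prod_(i <- r | P i) F i) = \prod_(i <- r | P i) meval v (F i).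
Proof. exact: (big_morph (meval v) (mevalM v) (meval1 v)). Qed.

Lemma meval_exp (f : mpoly n A) k : meval v (f ^+ k) = meval v f ^+ k.
Proof. by elim: k => [|k IH]; rewrite ?expr0 ?meval1 // !exprS mevalM IH. Qed.

End Evaluation.

Section Relation.
Variables (R : realType) (n p : nat).
Let N := n.+1.
Let M := p.+1.
Local Notation MM := (mpoly M (mpoly N R)).

(** [e] is the degree in the inner variables [x], later the coordinates of [X]; [d] is the degree in
    the outer variables [z], later those of [Z]. *)
Definition bihom (e d : nat) (F : MM) : Prop :=
  F \is ishomog1 d mdeg /\ forall m, mcoeff m F \is ishomog1 e mdeg.

Lemma bihomM e d e' d' F G :
  bihom e d F -> bihom e' d' G -> bihom (e + e') (d + d') (F * G).
Proof.
move=> [Fd Fe] [Gd Ge]; split; first exact: dhomogM.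
by move=> m; rewrite mcoeffM rpred_sum // => k _; apply: dhomogM.
Qed.

Lemma bihom1 : bihom 0 0 1.
Proof.
split; first exact: dhomog1.
by move=> m; rewrite mcoeff1; case: eqP => _; rewrite ?rpred0 ?dhomog1.
Qed.

Lemma bihom_exp e d F k : bihom e d F -> bihom (e * k) (d * k) (F ^+ k).
Proof.
move=> h; elim: k => [|k IH]; first by rewrite !muln0; exact: bihom1.
by rewrite exprS !mulnS; apply: bihomM.
Qed.

Lemma bihom_prod e d k (F : 'I_k -> MM) (a : 'I_k -> nat) :
  (forall i, bihom e d (F i)) ->
  bihom (e * \sum_i a i) (d * \sum_i a i) (\prod_i F i ^+ a i).
Proof.
move=> h; elim/big_rec2: _ => [|i y G _ IH]; first by rewrite !muln0; exact: bihom1.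
by rewrite !mulnDr; apply: bihomM => //; apply: bihom_exp.
Qed.

Lemma bihom_sum e d I (r : seq I) (F : I -> MM) :
  (forall i, bihom e d (F i)) -> bihom e d (\sum_(i <- r) F i).
Proof.
move=> h; split; first by rewrite rpred_sum // => i _; exact: (h i).1.
by move=> m; rewrite raddf_sum rpred_sum // => i _; exact: (h i).2.
Qed.

Lemma bihomX (f : mpoly N R) e m : f \is ishomog1 e mdeg ->
  bihom e (mdeg m) (f *: mpolyX _ m).
Proof.
move=> he; split; first by rewrite rpredZ // dhomogX.
by move=> k; rewrite mcoeffZ mcoeffX; case: eqP; rewrite ?mulr1 ?mulr0 ?rpred0.
Qed.

Definition ev2 (x : 'I_N -> R) (z : 'I_M -> R) (F : MM) : R :=
  meval x (meval (fun l => mpolyC N (z l)) F).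

Lemma ev2M x z : {morph ev2 x z : F G / F * G}.
Proof. by move=> F G; rewrite /ev2 !mevalM. Qed.

Lemma ev2_sum x z I (r : seq I) P (F : I -> MM) :
  ev2 x z (\sum_(i <- r | P i) F i) = \sum_(i <- r | P i) ev2 x z (F i).
Proof. by rewrite /ev2 (meval_sum (fun l => mpolyC N (z l))) (meval_sum x). Qed.

Lemma ev2_prod x z I (r : seq I) (F : I -> MM) (a : I -> nat) :
  ev2 x z (\prod_(i <- r) F i ^+ a i) = \prod_(i <- r) ev2 x z (F i) ^+ a i.
Proof.
rewrite /ev2 (meval_prod (fun l => mpolyC N (z l))) (meval_prod x).
apply: eq_bigr => i _.
by rewrite !meval_exp.
Qed.

Lemma ev2Z x z f F : ev2 x z (f *: F) = meval x f * ev2 x z F.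
Proof. by rewrite /ev2 mevalZ mevalM. Qed.

Lemma ev2_exp x z F k : ev2 x z (F ^+ k) = ev2 x z F ^+ k.
Proof. by rewrite /ev2 !meval_exp. Qed.

Lemma ev2X x z (f : mpoly N R) m :
  ev2 x z (f *: mpolyX _ m) = meval x f * \prod_l z l ^+ m l.
Proof.
rewrite /ev2 mevalZ mevalX mevalM (meval_prod x); congr (_ * _).
by apply: eq_bigr => i _; rewrite meval_exp mevalC.
Qed.

Variables (G : 'I_N -> 'I_M -> R) (H : 'I_M -> 'I_N -> 'I_M -> R) (T : 'I_N -> R).

Let zeta (i : 'I_N) : MM := \sum_l mpolyC N (G i l) *: mpolyX _ (mnm1 l).
Let W (j : 'I_M) : MM :=
  \sum_l (\sum_i H j i l *: mpolyX R (mnm1 i)) *: mpolyX _ (mnm1 l).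
Let tau : MM := (\sum_i T i *: mpolyX R (mnm1 i)) *: 1.

Let bihom_linear (c : 'I_N -> R) :
  \sum_i c i *: mpolyX R (mnm1 i) \is ishomog1 1 mdeg.
Proof. by rewrite rpred_sum // => i _; rewrite rpredZ // dhomogX /= mdeg1. Qed.

Let bihom_zeta i : bihom 0 1 (zeta i).
Proof.
apply: bihom_sum => l; have := @bihomX (mpolyC N (G i l)) 0 (mnm1 l); rewrite mdeg1; apply.
by rewrite -[mpolyC _ _]mulr1 mul_mpolyC rpredZ // dhomog1.
Qed.

Let bihom_W j : bihom 1 1 (W j).
Proof.
by apply: bihom_sum => l; have := bihomX (mnm1 l) (bihom_linear (H j ^~ l)); rewrite mdeg1.
Qed.

Let bihom_tau : bihom 1 0 tau.
Proof.
by rewrite /tau -mpolyX0; have := bihomX mnm0 (bihom_linear T); rewrite mdeg0.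
Qed.

(** Linear dependence by counting: the products of [D] factors [zeta i] or [W j], at most [E] of
    them [W j], lie in the space of bidegree [(E, D)] after multiplication by a power of [tau], and
    the hypothesis says that they outnumber its monomials. On [tau = 1] the padding disappears. *)
Lemma polynomial_relation D E : (E <= D)%N ->
  (nmon n E * nmon p D < \sum_(b < E.+1) nmon n (D - b) * nmon p b)%N ->
  exists P : MM, [/\ P != 0, forall m, (msize (mcoeff m P) <= D.+1)%N &
    forall x z, \sum_i T i * x i = 1 ->
      ev2 (fun i => \sum_l G i l * z l)
          (fun j => \sum_i \sum_l H j i l * x i * z l) P = 0].
Proof.
move=> ED hcount.
pose BN K := bmultinom N K; pose BM K := bmultinom M K.
pose S := [pred ab : BN D.+1 * BM D.+1 |
  (mdeg ab.1 + mdeg ab.2 == D)%N && (mdeg ab.2 <= E)%N].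
pose t := [pred ab : BN E.+1 * BM D.+1 | (mdeg ab.1 == E) && (mdeg ab.2 == D)].
(* [zeta] has degree 0 in [x] and [W] degree 1, so this power of [tau] brings all products to degree
   [E] in [x]. *)
pose F (ab : BN D.+1 * BM D.+1) : MM :=
  \prod_i zeta i ^+ (bmnm ab.1) i * \prod_j W j ^+ (bmnm ab.2) j * tau ^+ (E - mdeg ab.2).
have bihF ab : ab \in S -> bihom E D (F ab).
  case: ab => a b; rewrite inE /= => /andP[/eqP abD bE].
  have := bihomM (bihomM (bihom_prod (bmnm a) bihom_zeta) (bihom_prod (bmnm b) bihom_W))
    (bihom_exp (E - mdeg b) bihom_tau).
  by rewrite !mul0n !mul1n -!mdegE add0n addn0 subnKC // abD.
pose A : 'M[R]_(#|S|, #|t|) :=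
  \matrix_(i, j) mcoeff (bmnm (enum_val j).1) (mcoeff (bmnm (enum_val j).2) (F (enum_val i))).
have [u uA u0] : exists2 u : 'rV_#|S|, u *m A = 0 & u != 0.
  exists (nz_row (kermx A)); first by apply/sub_kermxP/nz_row_sub.
  rewrite nz_row_eq0 -mxrank_eq0 mxrank_ker -lt0n subn_gt0.
  apply: leq_ltn_trans (rank_leq_col _) _.
  by rewrite card_mdeg_pair // card_mdeg_sum.
have sumF : \sum_i mpolyC N (u 0 i) *: F (enum_val i) = 0.
  apply/mpolyP => g; apply/mpolyP => a; rewrite !mcoeff0 raddf_sum raddf_sum.
  under eq_bigr do rewrite /= mcoeffZ mul_mpolyC mcoeffZ.
  have [aE|aE] := eqVneq (mdeg a) E; last first.
    rewrite big1 // => i _.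
    by rewrite (dhomog_nemf_coeff ((bihF _ (enum_valP i)).2 g)) ?mulr0.
  have [gD|gD] := eqVneq (mdeg g) D; last first.
    rewrite big1 // => i _.
    by rewrite (dhomog_nemf_coeff (bihF _ (enum_valP i)).1) // mcoeff0 mulr0.
  have aE' : (mdeg a < E.+1)%N by rewrite aE.
  have gD' : (mdeg g < D.+1)%N by rewrite gD.
  pose ag : BN E.+1 * BM D.+1 := (BMultinom aE', BMultinom gD').
  have agt : ag \in t by rewrite inE /= aE gD !eqxx.
  have /matrixP /(_ 0 (enum_rank_in agt ag)) := uA.
  rewrite !mxE => h; rewrite -[RHS]h; apply: eq_bigr => i _.
  by rewrite mxE enum_rankK_in.
(* The type [MM] changes its meaning here: inner variables stand for the [zeta i] and outer ones for
   the [W j]. *)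
exists (\sum_i (u 0 i *: mpolyX R (bmnm (enum_val i).1)) *: mpolyX _ (bmnm (enum_val i).2)).
split.
- have [i0 ui0] : exists i, u 0 i != 0.
    by case/rV0Pn: u0 => i ui; exists i.
  apply/eqP => /mpolyP /(_ (bmnm (enum_val i0).2)) /mpolyP /(_ (bmnm (enum_val i0).1)).
  rewrite !mcoeff0 raddf_sum raddf_sum (bigD1 i0) //= mcoeffZ mcoeffX eqxx mulr1.
  rewrite mcoeffZ mcoeffX eqxx mulr1 big1 ?addr0; first exact/eqP.
  move=> i /eqP ni; rewrite mcoeffZ mcoeffX.
  case: eqP => [e2|_]; last by rewrite mulr0 mcoeff0.
  rewrite mulr1 mcoeffZ mcoeffX; case: eqP => [e1|_]; last by rewrite mulr0.
  by case: ni; apply: enum_val_inj; move: e1 e2; case: (enum_val i) (enum_val i0)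
    => a b [c d] /= /val_inj -> /val_inj ->.
- move=> m; rewrite raddf_sum; apply: leq_trans (msize_sum _ _ _) _.
  apply/bigmax_leqP => i _ /=; rewrite mcoeffZ mcoeffX.
  case: eqP => _; last by rewrite mulr0 msize0.
  rewrite mulr1; apply: leq_trans (msizeZ_le _ _) _; rewrite msizeX.
  exact: bmdeg.
move=> x z tx; have := congr1 (ev2 x z) sumF.
rewrite !ev2_sum [ev2 x z 0]/ev2 !meval0 => h; rewrite -[RHS]h.
have ezeta i : ev2 x z (zeta i) = \sum_l G i l * z l.
  rewrite ev2_sum; apply: eq_bigr => l _; rewrite ev2X mevalC; congr (_ * _).
  rewrite (bigD1 l) //= mnm1E eqxx expr1 big1 ?mulr1 // => k /negPf kl.
  by rewrite mnm1E eq_sym kl expr0.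
have elin (c : 'I_N -> R) : meval x (\sum_i c i *: mpolyX R (mnm1 i)) = \sum_i c i * x i.
  rewrite (meval_sum x); apply: eq_bigr => i _; rewrite mevalZ; congr (_ * _).
  exact: mevalXU.
have eW j : ev2 x z (W j) = \sum_i \sum_l H j i l * x i * z l.
  rewrite ev2_sum exchange_big; apply: eq_bigr => l _; rewrite ev2X elin -mulr_suml.
  congr (_ * _); rewrite (bigD1 l) //= mnm1E eqxx expr1 big1 ?mulr1 // => k /negPf kl.
  by rewrite mnm1E eq_sym kl expr0.
have etau : ev2 x z tau = 1.
  by rewrite /tau -mpolyX0 ev2X elin tx mul1r big1 // => i _; rewrite mnm0E expr0.
apply: eq_bigr => i _; rewrite ev2X mevalZ mevalX ev2Z mevalC !ev2M !ev2_prod ev2_exp.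
rewrite etau expr1n mulr1 -mulrA; congr (_ * (_ * _)); apply: eq_bigr => j _.
  by rewrite ezeta.
by rewrite eW.
Qed.

End Relation.

(** * Elimination of infinitesimal parameters *)

Section Substitution.

Lemma horner_mmap (R : comNzRingType) n (h : 'I_n -> {poly R}) (f : mpoly n R) q :
  (mmap polyC h f).[q] = meval (fun i => (h i).[q]) f.
Proof.
rewrite mevalE /mmap horner_sum; apply: eq_bigr => m _.
rewrite hornerM hornerC; congr (_ * _); rewrite /mmap1 horner_prod.
by apply: eq_bigr => i _; rewrite horner_exp.
Qed.

(** Each [g i j] is a scalar combination of the coefficients of [P], so the bound [D] persists
    however large the degree of [P] in the outer variables is. *)
Lemma line_expansion (R : comNzRingType) n m (P : mpoly m (mpoly n R)) (e w : 'I_m -> R) D :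
  (forall b, (msize (mcoeff b P) <= D.+1)%N) ->
  exists L (g : nat -> nat -> mpoly n R), (forall i j, (msize (g i j) <= D.+1)%N) /\
    forall z q s, meval z (meval (fun j => mpolyC n (s * e j + q * w j)) P) =
      \sum_(i < L) \sum_(j < L) q ^+ i * s ^+ j * meval z (g i j).
Proof.
move=> hD.
(* The outer indeterminate is [q], the inner one [s]. *)
pose mono (b : multinom m) : {poly {poly R}} :=
  \prod_(j < m) (('X * (e j)%:P)%:P + 'X * (w j)%:P%:P) ^+ b j.
(* A common bound on all sizes makes the index range independent of [b]. *)
pose L := (\max_(b <- msupp P) maxn (size (mono b)) (\max_(i < size (mono b)) size ((mono b)`_i)%R))%N.
exists L, (fun i j => \sum_(b <- msupp P) (mono b)`_i`_j *: mcoeff b P); split.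
  move=> i j; apply: leq_trans (msize_sum _ _ _) _; apply/bigmax_leqP_seq => b _ _.
  exact: leq_trans (msizeZ_le _ _) (hD b).
move=> z q s.
have -> : meval z (meval (fun j => mpolyC n (s * e j + q * w j)) P) =
    \sum_(b <- msupp P) meval z (mcoeff b P) * (mono b).[q%:P].[s].
  rewrite [X in meval z X]mevalE (meval_sum z); apply: eq_bigr => b _; rewrite mevalM; congr (_ * _).
  rewrite (meval_prod z) !horner_prod; apply: eq_bigr => j _.
  rewrite meval_exp mevalC !horner_exp hornerD hornerC hornerM hornerX hornerC.
  by rewrite hornerD !hornerM hornerX !hornerC.
under [RHS]eq_bigr do under eq_bigr do rewrite (meval_sum z) mulr_sumr.
under [RHS]eq_bigr do rewrite exchange_big.
rewrite exchange_big [LHS]big_seq [RHS]big_seq; apply: eq_bigr => b bP /=.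
have Lb : (maxn (size (mono b)) (\max_(i < size (mono b)) size ((mono b)`_i)%R) <= L)%N.
  by rewrite /L (big_rem b) //= leq_maxl.
have sz1 : (size (mono b) <= L)%N by apply: leq_trans Lb; exact: leq_maxl.
have sz2 i : (size ((mono b)`_i)%R <= L)%N.
  have [ib|/leq_sizeP ->] := ltnP i (size (mono b)); rewrite ?size_poly0 //.
  apply: leq_trans Lb; rewrite leq_max; apply/orP; right.
  exact: (leq_bigmax (Ordinal ib)).
under [RHS]eq_bigr do under eq_bigr do rewrite mevalZ.
move: (meval z (mcoeff b P)) => y.
rewrite (horner_coef_wide _ sz1) horner_sum mulr_sumr; apply: eq_bigr => i _.
rewrite hornerM horner_exp hornerC (horner_coef_wide _ (sz2 _)) mulr_suml mulr_sumr.
by apply: eq_bigr => j _; ring.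
Qed.

(** Substituting affine forms does not raise the degree; grouping by powers of [r] leaves
    coefficients of degree at most [D] in [c]. *)
Lemma affine_expansion (R : idomainType) n k (f : mpoly n R) (a w : 'I_n -> R)
    (b : 'I_n -> 'I_k -> R) D : (msize f <= D.+1)%N ->
  exists L (g : nat -> mpoly k R), (forall i, (msize (g i) <= D.+1)%N) /\
    forall c r, meval (fun i => a i + \sum_l b i l * c l + r * w i) f =
      \sum_(i < L) r ^+ i * meval c (g i).
Proof.
move=> hD.
(* [F] is a polynomial in [r]; [dg d F] bounds the degree in [c] of each of its coefficients. *)
pose dg d (F : {poly mpoly k R}) := forall i, (msize F`_i <= d.+1)%N.
have dgM d e F G : dg d F -> dg e G -> dg (d + e)%N (F * G).
  move=> hF hG i; rewrite coefM; apply: leq_trans (msize_sum _ _ _) _.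
  apply/bigmax_leqP => j _.
  have [->|F0] := eqVneq F`_j 0; first by rewrite mul0r msize0.
  have [->|G0] := eqVneq G`_(i - j) 0; first by rewrite mulr0 msize0.
  rewrite msizeM //; have := leq_add (hF j) (hG (i - j)%N); rewrite addSn addnS.
  by case: (_ + _)%N => // u; rewrite ltnS.
have dg1 : dg 0%N 1.
  by move=> i; rewrite coef1; case: eqP => _; rewrite ?msize1 ?msize0.
have dgX d F i : dg d F -> dg (d * i)%N (F ^+ i).
  by move=> hF; elim: i => [|i IH]; rewrite ?muln0 // exprS mulnS; apply: dgM.
pose ell i : {poly mpoly k R} :=
  (mpolyC k (a i) + \sum_l b i l *: mpolyX R (mnm1 l))%:P + (mpolyC k (w i))%:P * 'X.
have dgell i : dg 1%N (ell i).
  move=> j; rewrite /ell coefD coefC coefMX !coefC.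
  have hC x : (msize (mpolyC k x) <= 2)%N.
    by rewrite msizeC; case: (x != 0).
  case: j => [|[|j]] /=; rewrite ?add0r ?addr0 ?msize0 //.
  apply: leq_trans (msizeD_le _ _) _; rewrite geq_max hC.
  apply: leq_trans (msize_sum _ _ _) _; apply/bigmax_leqP => l _.
  by apply: leq_trans (msizeZ_le _ _) _; rewrite msizeX mdeg1.
pose H : {poly mpoly k R} := mmap (fun x => (mpolyC k x)%:P) ell f.
exists (size H), (fun i => H`_i); split.
  move=> i; rewrite /H /mmap coef_sum; apply: leq_trans (msize_sum _ _ _) _.
  apply/bigmax_leqP_seq => m mf _; rewrite coefCM mul_mpolyC.
  apply: leq_trans (msizeZ_le _ _) _.
  have : dg (mdeg m) (mmap1 ell m).
    rewrite mdegE /mmap1.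
    elim/big_rec2: _ => // j F d _ hd; apply: dgM => //.
    by have := dgX _ _ (m j) (dgell j); rewrite mul1n.
  move=> /(_ i) /leq_trans; apply; apply: leq_trans (msize_mdeg_lt mf) hD.
move=> c r.
transitivity (map_poly (meval c) H).[r].
  rewrite mevalE /H /mmap rmorph_sum horner_sum; apply: eq_bigr => m _.
  rewrite rmorphM /= map_polyC hornerM hornerC /= mevalC; congr (_ * _).
  rewrite /mmap1 rmorph_prod horner_prod; apply: eq_bigr => i _.
  rewrite rmorphXn horner_exp; congr (_ ^+ _).
  rewrite /= /ell rmorphD rmorphM /= !map_polyC map_polyX hornerD hornerM.
  rewrite !hornerC hornerX /= mevalC mevalD mevalC (meval_sum c) mulrC; congr (_ + _ + _).
  by apply: eq_bigr => l _; rewrite mevalZ; congr (_ * _); apply/esym/mevalXU.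
rewrite (@horner_coef_wide _ (size H)); last exact: size_poly.
by apply: eq_bigr => i _; rewrite coef_map mulrC.
Qed.

End Substitution.

Section Elimination.
Variable R : realType.

Lemma meval_lipschitz k (f : mpoly k R) c : exists2 K, 0 <= K &
  forall d c', 0 <= d <= 1 -> (forall l, `|c' l - c l| <= d) ->
    `|meval c' f - meval c f| <= K * d.
Proof.
pose lip (F : ('I_k -> R) -> R) := exists2 K, 0 <= K &
  forall d c', 0 <= d <= 1 -> (forall l, `|c' l - c l| <= d) -> `|F c' - F c| <= K * d.
have lipC x : lip (fun=> x) by exists 0 => // d c' _ _; rewrite subrr normr0 mul0r.
have lipX l : lip (fun c => c l) by exists 1 => // d c' _ h; rewrite mul1r.
have lipD F G : lip F -> lip G -> lip (fun c => F c + G c).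
  move=> [K K0 hK] [K' K'0 hK']; exists (K + K'); first exact: addr_ge0.
  move=> d c' hd h; rewrite opprD addrACA mulrDl.
  by rewrite (le_trans (ler_normD _ _)) // lerD ?hK ?hK'.
have lipM F G : lip F -> lip G -> lip (fun c => F c * G c).
  move=> [K K0 hK] [K' K'0 hK']; exists (K * (`|G c| + K') + `|F c| * K').
    by rewrite addr_ge0 ?mulr_ge0 ?addr_ge0.
  move=> d c' hd h; have [d0 d1] := andP hd.
  have -> : F c' * G c' - F c * G c = (F c' - F c) * G c' + F c * (G c' - G c) by ring.
  rewrite (le_trans (ler_normD _ _)) // !normrM mulrDl lerD //.
    rewrite -mulrA [_ * d]mulrC mulrA ler_pM ?hK //.
    rewrite -[G c'](subrK (G c)) addrC (le_trans (ler_normD _ _)) // lerD2l.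
    by rewrite (le_trans (hK' _ _ hd h)) // ler_piMr.
  by rewrite -mulrA ler_wpM2l ?hK'.
have lipE F n : lip F -> lip (fun c => F c ^+ n).
  move=> hF; elim: n => [|n IH]; first by under eq_fun do rewrite expr0.
  under eq_fun do rewrite exprS.
  exact/lipM.
have [K K0 hK] : lip (fun c => meval c f).
  under eq_fun do rewrite mevalE.
  elim: (msupp f) => [|m s IH]; first by under eq_fun do rewrite big_nil.
  under eq_fun do rewrite big_cons.
  apply/lipD => //; apply/lipM => //.
  elim: (index_enum _) => [|i t IHt]; first by under eq_fun do rewrite big_nil.
  under eq_fun do rewrite big_cons.
  by apply/lipM => //; apply/lipE.
by exists K.
Qed.

(** Divide by [x ^+ i]: the terms after [u i] keep a factor [x]. The estimate is explicit because
    the [u j] vary with the other parameters, so no limit can be taken termwise. *)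
Lemma lowest_term_bound (u : nat -> R) L i x : (i < L)%N -> 0 < x <= 1 ->
  (forall j, (j < i)%N -> u j = 0) ->
  `|u i| <= `|\sum_(j < L) x ^+ j * u j| / x ^+ i + x * \sum_(j < L) `|u j|.
Proof.
move=> iL /andP[x0 x1] ui.
have -> : u i = (\sum_(j < L) x ^+ j * u j) / x ^+ i
    - x * \sum_(j < L | (i < j)%N) x ^+ (j - i).-1 * u j.
  rewrite mulr_suml mulr_sumr (bigD1 (Ordinal iL)) //= mulrAC divff ?mul1r; last first.
    by rewrite expf_neq0 // gt_eqF.
  rewrite -addrA -[LHS]addr0; congr (_ + _); apply/esym/eqP; rewrite subr_eq0; apply/eqP.
  rewrite [RHS]big_mkcond [LHS]big_mkcond; apply: eq_bigr => j _ /=.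
  rewrite -val_eqE /=; case: (ltngtP j i) => //= [ji|ij]; first by rewrite ui ?mulr0 ?mul0r.
  have -> : x ^+ j = x ^+ i * (x * x ^+ (j - i).-1).
    by rewrite -exprS prednK ?subn_gt0 // -exprD subnKC // ltnW.
  have := expf_neq0 i (lt0r_neq0 x0); move: (x ^+ i) => y y0.
  by field.
rewrite (le_trans (ler_normB _ _)) // lerD //.
  by rewrite normrM normfV [`|x ^+ i|]ger0_norm // exprn_ge0 // ltW.
rewrite normrM (gtr0_norm x0) ler_pM2l // (le_trans (ler_norm_sum _ _ _)) //.
rewrite big_mkcond ler_sum // => j _; case: ifP => // _.
rewrite normrM ler_piMl // ger0_norm ?exprn_ge0 ?exprn_ile1 // ltW //.
Qed.

(* [p] is the lowest coefficient of [P] in [q], then in [r], then in [s]. *)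
Lemma elimination n m k (P : mpoly m (mpoly n R)) D (e : 'I_m -> R)
    (a : 'I_n -> R) (b : 'I_n -> 'I_k -> R) :
  P != 0 -> (forall j, (msize (mcoeff j P) <= D.+1)%N) ->
  exists (w : 'I_m -> R) (eta : 'I_n -> R) (p : mpoly k R),
    [/\ p != 0, (msize p <= D.+1)%N & forall c : 'I_k -> R,
    (forall eps : R, 0 < eps <= 1 -> exists (c' : 'I_k -> R) (sig : R),
      [/\ forall l, `|c' l - c l| <= eps, 0 < sig & forall rho : R, 0 < rho ->
       exists (r s : R) (h : 'I_n -> {poly R}),
        [/\ 0 < r <= rho, sig <= s <= eps,
         forall i, (h i).[0] = a i + \sum_l b i l * c' l + r * eta i &
         forall q, meval (fun i => (h i).[q])
           (meval (fun j => mpolyC n (s * e j + q * w j)) P) = 0]]) ->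
    meval c p = 0].
Proof.
move=> P0 hD.
have [W0 W0P] : exists W0 : 'I_m -> R, meval (fun j => mpolyC n (W0 j)) P != 0.
  have [b0 Pb0] : exists b0, mcoeff b0 P != 0.
    apply: contrapT => h; case/negP: P0; apply/eqP/mpolyP => j; rewrite mcoeff0.
    by apply/eqP; apply: contra_notT h => hj; exists j.
  have [a0 Pa0] : exists a0, mcoeff a0 (mcoeff b0 P) != 0.
    apply: contrapT => h; case/negP: Pb0; apply/eqP/mpolyP => j; rewrite mcoeff0.
    by apply/eqP; apply: contra_notT h => hj; exists j.
  (* [Q] collects the coefficients of [P] at [a0]; at a nonroot of [Q] the specialized [P] keeps a
     nonzero coefficient there. *)
  pose Q : mpoly m R := \sum_(j <- msupp P) mcoeff a0 (mcoeff j P) *: mpolyX R j.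
  have Q0 : Q != 0.
    apply/eqP => /mpolyP /(_ b0) /eqP; rewrite mcoeff0 raddf_sum.
    rewrite (bigD1_seq b0) ?msupp_uniq ?mcoeff_msupp //= mcoeffZ mcoeffX eqxx mulr1.
    rewrite big1 ?addr0 ?(negPf Pa0) // => j /negPf jb.
    by rewrite mcoeffZ mcoeffX jb mulr0.
  have [W0 hW] := mpoly_nonroot Q0; exists W0.
  apply: contra_neq hW => /mpolyP /(_ a0); rewrite mcoeff0 => <-.
  rewrite /Q (meval_sum W0) [X in mcoeff _ X]mevalE (raddf_sum (mcoeff a0)); apply: eq_bigr => j _.
  rewrite mevalZ mevalX /=.
  have -> : \prod_i mpolyC n (W0 i) ^+ j i = mpolyC n (\prod_i W0 i ^+ j i).
    by rewrite rmorph_prod; apply: eq_bigr => i _; rewrite rmorphXn.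
  by rewrite [in RHS]mulrC mcoeffCM mulrC.
have [z0 z0P] := mpoly_nonroot W0P.
(* At [s = q = 1] the point [s e + q w] is [W0], so some coefficient of the expansion is nonzero. *)
pose w j := W0 j - e j; exists w.
have [L [g [hg gE]]] := line_expansion e w hD.
pose nz (i : nat) := (i < L)%N && [exists j : 'I_L, g i j != 0].
have exnz : exists i, nz i.
  apply: contrapT => h; case/negP: z0P; apply/eqP.
  transitivity (meval z0 (meval (fun j => mpolyC n (1 * e j + 1 * w j)) P)).
    suff -> : (fun j => mpolyC n (1 * e j + 1 * w j)) = (fun j => mpolyC n (W0 j)) by [].
    by apply/funext => j; rewrite !mul1r /w addrC subrK.
  rewrite gE big1 // => i _; rewrite big1 // => j _.
  suff -> : g i j = 0 by rewrite meval0 mulr0.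
  apply/eqP; apply: contra_notT h => hij; exists i; rewrite /nz ltn_ord.
  by apply/existsP; exists j.
have [i0 /andP[i0L /existsP[j1 gj1]] i0min] := ex_minnP exnz.
have [z1 z1P] := mpoly_nonroot gj1.
(* At [c = 0] and [r = 1] the affine point is [z1], where [g i0 j1] does not vanish. *)
pose eta i := z1 i - a i; exists eta.
have /choice[LG hLG] j : exists x : nat * (nat -> mpoly k R),
    (forall i, (msize (x.2 i) <= D.+1)%N) /\
    forall c r, meval (fun i => a i + \sum_l b i l * c l + r * eta i) (g i0 j) =
      \sum_(i < x.1) r ^+ i * meval c (x.2 i).
  by have [L1 [g1 h1]] := affine_expansion a eta b (hg i0 j); exists (L1, g1).
pose L2 := (\max_(j < L) (LG j).1)%N.
pose G i j := if (i < (LG j).1)%N then (LG j).2 i else 0.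
have hG i j : (msize (G i j) <= D.+1)%N.
  by rewrite /G; case: ifP => _; rewrite ?msize0 //; case: (hLG j).
have GE c r (j : 'I_L) : meval (fun i => a i + \sum_l b i l * c l + r * eta i) (g i0 j) =
    \sum_(i < L2) r ^+ i * meval c (G i j).
  have [_ ->] := hLG j.
  rewrite (big_ord_widen L2 (fun i => r ^+ i * meval c ((LG j).2 i))); last first.
    exact: leq_bigmax.
  rewrite big_mkcond; apply: eq_bigr => i _; rewrite /G; case: ifP => // _.
  by rewrite meval0 mulr0.
pose nz' (i : nat) := (i < L2)%N && [exists j : 'I_L, G i j != 0].
have exnz' : exists i, nz' i.
  apply: contrapT => h; case/negP: z1P; apply/eqP.
  have := GE (fun=> 0) 1 j1; rewrite big1; last first.
    move=> i _; suff -> : G i j1 = 0 by rewrite meval0 mulr0.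
    apply/eqP; apply: contra_notT h => hij; exists i; rewrite /nz' ltn_ord.
    by apply/existsP; exists j1.
  suff -> : (fun i => a i + \sum_l b i l * 0 + 1 * eta i) = z1 by [].
  apply/funext => i; rewrite mul1r big1; last by move=> l _; rewrite mulr0.
  by rewrite addr0 /eta addrC subrK.
have [i1 /andP[i1L /existsP[j2 Gj2]] i1min] := ex_minnP exnz'.
have [j0 /andP[j0L Gj0] j0min] : exists2 j0, (j0 < L)%N && (G i1 j0 != 0) &
    forall j, (j < L)%N && (G i1 j != 0) -> (j0 <= j)%N.
  have ex : exists j, (j < L)%N && (G i1 j != 0) by exists j2; rewrite ltn_ord.
  by have [j0] := ex_minnP ex; exists j0.
exists (G i1 j0); split => // c happ.
have g_low i (j : 'I_L) : (i < i0)%N -> g i j = 0.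
  move=> ii0; apply/eqP; apply: contraTT (ii0) => gij; rewrite -leqNgt; apply: i0min.
  rewrite /nz; apply/andP; split; last by apply/existsP; exists j.
  by rewrite (ltn_trans ii0 i0L).
have key s (h : 'I_n -> {poly R}) :
    (forall q, meval (fun i => (h i).[q])
       (meval (fun j => mpolyC n (s * e j + q * w j)) P) = 0) ->
    \sum_(j < L) s ^+ j * meval (fun i => (h i).[0]) (g i0 j) = 0.
  move=> hq.
  pose c1 i : {poly R} := \sum_(j < L) (s ^+ j)%:P * mmap polyC h (g i j).
  have c1E i q : (c1 i).[q] = \sum_(j < L) s ^+ j * meval (fun i => (h i).[q]) (g i j).
    by rewrite horner_sum; apply: eq_bigr => j _; rewrite hornerM hornerC horner_mmap.
  (* The relation divided by [q ^+ i0]: being zero as a polynomial, it can be evaluated at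
     [q = 0]. *)
  pose F1 : {poly R} := \sum_(i < L | (i0 <= i)%N) 'X^(i - i0) * c1 i.
  have F10 : F1 = 0.
    apply: contrapT => /eqP F1n.
    have : 'X^i0 * F1 != 0 by rewrite mulf_neq0 // monic_neq0 // monicXn.
    case/poly_nonroot => q /eqP; apply; rewrite -[RHS](hq q) gE.
    rewrite hornerM horner_sum mulr_sumr big_mkcond; apply: eq_bigr => i _ /=.
    case: leqP => ii0; last by rewrite big1 // => j _; rewrite g_low // meval0 mulr0.
    rewrite hornerM !hornerXn mulrA -exprD subnKC // c1E mulr_sumr.
    by apply: eq_bigr => j _; rewrite mulrA.
  rewrite -c1E; suff <- : F1.[0] = (c1 i0).[0] by rewrite F10 horner0.
  rewrite /F1 horner_sum (bigD1 (Ordinal i0L)) //=.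
  rewrite hornerM subnn expr0 hornerC mul1r big1 ?addr0 // => i /andP[ii0 ni].
  have /negPf ni' : (i - i0 != 0)%N.
    by rewrite subn_eq0 -ltnNge ltn_neqAle ii0 andbT eq_sym.
  by rewrite hornerM hornerXn expr0n ni' mul0r.
have /choice[K hK] j : exists K, 0 <= K /\ forall d c', 0 <= d <= 1 ->
    (forall l, `|c' l - c l| <= d) -> `|meval c' (G i1 j) - meval c (G i1 j)| <= K * d.
  by have [K K0 hK] := meval_lipschitz (G i1 j) c; exists K.
pose C := 1 + K j0 + \sum_(j < L) (`|meval c (G i1 j)| + K j).
have C0 : 0 < C.
  rewrite /C -addrA ltr_pwDl // addr_ge0 ?(hK _).1 // sumr_ge0 // => j _.
  by rewrite addr_ge0 ?(hK _).1.
suff bound eps : 0 < eps <= 1 -> `|meval c (G i1 j0)| <= eps * C.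
  apply/eqP/negPn/negP => n0.
  pose x := `|meval c (G i1 j0)|; have x0 : 0 < x by rewrite normr_gt0.
  have h : 0 < Num.min 1 (x / (2 * C)) <= 1.
    by rewrite lt_min ltr01 divr_gt0 ?mulr_gt0 //= ge_min lexx.
  have := bound _ h; rewrite -/x leNgt => /negP; apply.
  rewrite (@le_lt_trans _ _ (x / (2 * C) * C)) // ?ler_pM2r // ?ge_min ?lexx ?orbT //.
  have -> : x / (2 * C) * C = x / 2 by field; rewrite gt_eqF.
  by rewrite ltr_pdivrMr // ltr_pMr // ltr1n.
move=> heps; have [eps0 eps1] := andP heps.
have [c' [sig [hc' sig0 hrho]]] := happ eps heps.
pose A i j := meval c' (G i j).
pose K' := \sum_(i < L2) \sum_(j < L) `|A i j|.
have K'0 : 0 <= K' by rewrite sumr_ge0 // => i _; rewrite sumr_ge0.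
(* [r] must be small against [s ^+ j0]; this is where the lower bound [sig] on [s], fixed before
   [rho], enters. *)
pose rho := Num.min 1 (eps * sig ^+ j0 / (K' + 1)).
have rho0 : 0 < rho.
  by rewrite lt_min ltr01 divr_gt0 ?mulr_gt0 ?exprn_gt0 // ltr_wpDl.
have [r [s [h [/andP[r0 rrho] /andP[sigs seps] hh0 hq]]]] := hrho rho rho0.
have s0 : 0 < s by apply: lt_le_trans sigs.
have s1 : s <= 1 by apply: le_trans eps1.
have r1 : r <= 1 by rewrite (le_trans rrho) // ge_min lexx.
pose u i := \sum_(j < L) s ^+ j * A i j.
have u0 : \sum_(i < L2) r ^+ i * u i = 0.
  rewrite -[RHS](key s h hq) (funext hh0).
  under eq_bigr do rewrite mulr_sumr; rewrite exchange_big; apply: eq_bigr => j _.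
  by rewrite GE mulr_sumr; apply: eq_bigr => i _; rewrite /A; ring.
have hu i : `|u i| <= \sum_(j < L) `|A i j|.
  rewrite (le_trans (ler_norm_sum _ _ _)) // ler_sum // => j _.
  by rewrite normrM ler_piMl // ger0_norm ?exprn_ge0 ?exprn_ile1 // ltW.
have A_low i (j : 'I_L) : (i < i1)%N -> A i j = 0.
  move=> ii1; rewrite /A; suff -> : G i j = 0 by rewrite meval0.
  apply/eqP; apply: contraTT (ii1) => gij; rewrite -leqNgt; apply: i1min.
  rewrite /nz'; apply/andP; split; last by apply/existsP; exists j.
  by rewrite (ltn_trans ii1 i1L).
have A_low' j : (j < j0)%N -> A i1 j = 0.
  move=> jj0; rewrite /A; suff -> : G i1 j = 0 by rewrite meval0.
  apply/eqP; apply: contraTT (jj0) => gij; rewrite -leqNgt; apply: j0min.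
  by rewrite gij (ltn_trans jj0).
have u1 : `|u i1| <= r * K'.
  have := @lowest_term_bound u L2 i1 r i1L; rewrite r0 r1 u0 normr0 mul0r add0r.
  move=> /(_ isT) h1; apply: le_trans (h1 _) _.
    by move=> j ji; rewrite /u big1 // => l _; rewrite A_low // mulr0.
  by rewrite ler_pM2l // ler_sum.
have A1 : `|A i1 j0| <= eps * (1 + \sum_(j < L) (`|meval c (G i1 j)| + K j)).
  have := @lowest_term_bound (A i1) L j0 s j0L; rewrite s0 s1 -/(u i1).
  move=> /(_ isT A_low') h1; apply: (le_trans h1); rewrite mulrDr mulr1 lerD //.
    rewrite ler_pdivrMr ?exprn_gt0 // (le_trans u1) //.
    have : rho * (K' + 1) <= eps * sig ^+ j0.
      by rewrite -ler_pdivlMr ?ltr_wpDl // ge_min lexx orbT.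
    move=> hr; apply: (@le_trans _ _ (rho * (K' + 1))).
      by rewrite ler_pM ?(ltW r0) // lerDl.
    by rewrite (le_trans hr) // ler_pM2l // lerXn2r // nnegrE ltW.
  rewrite ler_pM ?(ltW s0) ?sumr_ge0 // ler_sum // => j _.
  rewrite -[A i1 j](subrK (meval c (G i1 j))) addrC (le_trans (ler_normD _ _)) // lerD2l.
  have [Kj0 hKj] := hK j; rewrite (le_trans (hKj eps c' _ hc')) ?(ltW eps0) //.
  by rewrite ler_piMr.
have [Kj0 hKj] := hK j0; have := hKj eps c'; rewrite (ltW eps0) eps1 => /(_ isT hc').
rewrite -/(A i1 j0) distrC => h1.
rewrite -[meval c _](subrK (A i1 j0)) (le_trans (ler_normD _ _)) //.
rewrite (le_trans (lerD h1 A1)) // /C; lra.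
Qed.

End Elimination.

(** * Positive semidefinite matrices *)

Local Open Scope classical_set_scope.
Local Open Scope ring_scope.

Section PSD.
Variable R : realType.

Definition qf n (A : 'M[R]_n) (u : 'rV[R]_n) : R := (u *m A *m u^T) 0 0.
Definition bf n (A : 'M[R]_n) (u v : 'rV[R]_n) : R := (u *m A *m v^T) 0 0.
Definition pd n (A : 'M[R]_n) : Prop :=
  A^T = A /\ forall u : 'rV[R]_n, u != 0 -> 0 < qf A u.

Lemma symmetricmxE n (A : 'M[R]_n) : (A \is symmetricmx) = (A^T == A).
Proof.
rewrite qualifE /= expr0 scale1r eq_sym; congr (_ == _).
by apply/matrixP => i j; rewrite !mxE.
Qed.

Lemma psdP n (A : 'M[R]_n) : psd A <-> A^T = A /\ forall u, 0 <= qf A u.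
Proof. by rewrite /psd symmetricmxE; split => -[/eqP]. Qed.

Lemma bfC n (A : 'M[R]_n) u v : A^T = A -> bf A u v = bf A v u.
Proof.
move=> sA; rewrite /bf -[LHS](mxE trmx_key (fun i j => (u *m A *m v^T) j i)).
by rewrite -/(trmx _) !trmx_mul trmxK sA mulmxA.
Qed.

Lemma bfD n (A : 'M[R]_n) u v w : bf A (u + v) w = bf A u w + bf A v w.
Proof. by rewrite /bf !mulmxDl mxE. Qed.

Lemma bfZ n (A : 'M[R]_n) a u v : bf A (a *: u) v = a * bf A u v.
Proof. by rewrite /bf -!scalemxAl mxE. Qed.

Lemma qfD n (A : 'M[R]_n) u v : A^T = A ->
  qf A (u + v) = qf A u + 2 * bf A u v + qf A v.
Proof.
move=> sA; rewrite -!/(bf A _ _) /qf -!/(bf A _ _) bfD !(bfC _ (u + v)) // !bfD.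
by rewrite (bfC v u) //; ring.
Qed.

Lemma qfZ n (A : 'M[R]_n) a u : qf A (a *: u) = a ^+ 2 * qf A u.
Proof. by rewrite /qf linearZ /= -scalemxAr -!scalemxAl !mxE mulrA. Qed.

Lemma qfDm n (A B : 'M[R]_n) u : qf (A + B) u = qf A u + qf B u.
Proof. by rewrite /qf mulmxDr mulmxDl mxE. Qed.

Lemma qfZm n a (A : 'M[R]_n) u : qf (a *: A) u = a * qf A u.
Proof. by rewrite /qf -scalemxAr -scalemxAl mxE. Qed.

Lemma qf0 n (u : 'rV[R]_n) : qf 0 u = 0.
Proof. by rewrite /qf mulmx0 mul0mx mxE. Qed.

Lemma qf1 n (u : 'rV[R]_n) : qf 1%:M u = \sum_i u 0 i ^+ 2.
Proof. by rewrite /qf mulmx1 mxE; apply: eq_bigr => i _; rewrite mxE expr2. Qed.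

Lemma qf1_ge0 n (u : 'rV[R]_n) : 0 <= qf 1%:M u.
Proof. by rewrite qf1 sumr_ge0 // => i _; rewrite sqr_ge0. Qed.

Lemma qf1_gt0 n (u : 'rV[R]_n) : u != 0 -> 0 < qf 1%:M u.
Proof.
move=> u0; rewrite lt_def qf1_ge0 andbT; apply: contra_neq u0.
rewrite qf1 => /psumr_eq0P h; apply/rowP => i; rewrite mxE; apply/eqP.
by rewrite -sqrf_eq0 h // => j _; rewrite sqr_ge0.
Qed.

Lemma qf_congr m n (G : 'M[R]_(m, n)) (A : 'M[R]_n) u :
  qf (G *m A *m G^T) u = qf A (u *m G).
Proof. by rewrite /qf trmx_mul !mulmxA. Qed.

Lemma psd_congr m n (G : 'M[R]_(m, n)) A : psd A -> psd (G *m A *m G^T).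
Proof.
rewrite !psdP => -[sA hA]; split; last by move=> u; rewrite qf_congr.
by rewrite !trmx_mul trmxK sA mulmxA.
Qed.

Lemma psdD n (A B : 'M[R]_n) : psd A -> psd B -> psd (A + B).
Proof.
rewrite !psdP => -[sA hA] [sB hB]; split; first by rewrite linearD /= sA sB.
by move=> u; rewrite qfDm addr_ge0.
Qed.

Lemma psdZ n a (A : 'M[R]_n) : 0 <= a -> psd A -> psd (a *: A).
Proof.
rewrite !psdP => a0 [sA hA]; split; first by rewrite linearZ /= sA.
by move=> u; rewrite qfZm mulr_ge0.
Qed.

Lemma pd_psd n (A : 'M[R]_n) : pd A -> psd A.
Proof.
rewrite psdP => -[sA hA]; split => // u; have [->|/hA/ltW//] := eqVneq u 0.
by rewrite /qf !mul0mx mxE.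
Qed.

Lemma pdDl n (A B : 'M[R]_n) : pd A -> psd B -> pd (A + B).
Proof.
rewrite psdP => -[sA hA] [sB hB]; split; first by rewrite linearD /= sA sB.
by move=> u u0; rewrite qfDm ltr_pwDl // hA.
Qed.

Lemma pdZ n a (A : 'M[R]_n) : 0 < a -> pd A -> pd (a *: A).
Proof.
move=> a0 [sA hA]; split; first by rewrite linearZ /= sA.
by move=> u u0; rewrite qfZm mulr_gt0 ?hA.
Qed.

Lemma psd_CS n (A : 'M[R]_n) u v : psd A -> bf A u v ^+ 2 <= qf A u * qf A v.
Proof.
rewrite psdP => -[sA hA].
have h t : 0 <= qf A u + 2 * t * bf A u v + t ^+ 2 * qf A v.
  by have := hA (u + t *: v); rewrite qfD // qfZ (bfC u) // bfZ (bfC v) // mulrA.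
have [v0|v0] := eqVneq (qf A v) 0.
  rewrite v0 mulr0 le_eqVlt; apply/orP; left; rewrite sqrf_eq0.
  (* The quadratic is linear in [t] here, and this [t] would give it the value -1. *)
  apply: contraT => b0; have := h (- (qf A u + 1) / (2 * bf A u v)); rewrite v0 mulr0 addr0.
  have -> : 2 * (- (qf A u + 1) / (2 * bf A u v)) * bf A u v = - (qf A u + 1) by field.
  by rewrite opprD addrA subrr add0r oppr_ge0 leNgt ltr01.
have v1 : 0 < qf A v by rewrite lt_def v0 hA.
have := h (- bf A u v / qf A v).
have -> : qf A u + 2 * (- bf A u v / qf A v) * bf A u v + (- bf A u v / qf A v) ^+ 2 * qf A v
   = (qf A u * qf A v - bf A u v ^+ 2) / qf A v by field.
by rewrite pmulr_lge0 ?invr_gt0 // subr_ge0.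
Qed.

Lemma psd_ker n (A : 'M[R]_n) u : psd A -> qf A u = 0 -> u *m A = 0.
Proof.
move=> hA u0; apply/rowP => i; rewrite [RHS]mxE; apply/eqP; rewrite -sqrf_eq0.
have := psd_CS u (delta_mx 0 i) hA; rewrite u0 mul0r.
have -> : bf A u (delta_mx 0 i) = (u *m A) 0 i by rewrite /bf trmx_delta -colE mxE.
by move=> h; rewrite eq_le h sqr_ge0.
Qed.

Lemma qf_delta n (A : 'M[R]_n) i : qf A (delta_mx 0 i) = A i i.
Proof. by rewrite /qf -rowE trmx_delta -colE !mxE. Qed.

Lemma bf_delta n (A : 'M[R]_n) i j : bf A (delta_mx 0 i) (delta_mx 0 j) = A i j.
Proof. by rewrite /bf -rowE trmx_delta -colE !mxE. Qed.

Lemma psd_diag n (A : 'M[R]_n) i : psd A -> 0 <= A i i.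
Proof. by rewrite psdP -qf_delta => -[]. Qed.

Lemma psd_trace_ge0 n (A : 'M[R]_n) : psd A -> 0 <= \tr A.
Proof. by move=> hA; rewrite sumr_ge0 // => i _; apply: psd_diag. Qed.

Lemma psd_entry_le n (A : 'M[R]_n) i j : psd A -> `|A i j| <= \tr A.
Proof.
move=> hA; have dl k : A k k <= \tr A.
  by rewrite /mxtrace (bigD1 k) //= lerDl sumr_ge0 // => l _; apply: psd_diag.
have := psd_CS (delta_mx 0 i) (delta_mx 0 j) hA; rewrite bf_delta !qf_delta => h.
rewrite -ler_sqr ?nnegrE ?psd_trace_ge0 // -normrX ger0_norm ?sqr_ge0 //.
by rewrite (le_trans h) // expr2 ler_pM ?psd_diag.
Qed.

Lemma psd_trace_eq0 n (A : 'M[R]_n) : psd A -> \tr A = 0 -> A = 0.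
Proof.
move=> hA t0; apply/matrixP => i j; rewrite mxE.
by apply/eqP; rewrite -normr_le0 -t0 psd_entry_le.
Qed.

(* Peel off rank one pieces [(u A)^T (u A) / qf A u] of [A]. *)
Lemma psd_mxtrace_mul n (A B : 'M[R]_n) : psd A -> psd B -> 0 <= \tr (A *m B).
Proof.
move=> hA hB; have [r] := ubnP (\rank A); elim: r A hA => // r IH A hA rA.
have [->|/eqP A0] := eqVneq A 0; first by rewrite mul0mx mxtrace0.
have [u qu] : exists u, qf A u != 0.
  apply: contrapT => h; apply: A0; apply: psd_trace_eq0 => //.
  rewrite /mxtrace big1 // => i _; rewrite -qf_delta.
  by apply/eqP; apply: contra_notT h => hu; exists (delta_mx 0 i).
have [sA qA] := (psdP A).1 hA; have [sB qB] := (psdP B).1 hB.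
have q0 : 0 < qf A u by rewrite lt_def qu qA.
pose w := u *m A; pose A' := A - (qf A u)^-1 *: (w^T *m w).
have wE v : (v *m w^T) 0 0 = bf A v u by rewrite /w trmx_mul sA mulmxA.
have hA' : psd A'.
  rewrite psdP; split.
    by rewrite /A' linearB linearZ /= trmx_mul trmxK sA.
  move=> v; have -> : qf A' v = qf A v - (qf A u)^-1 * bf A v u ^+ 2.
    rewrite /A' qfDm -scaleNr qfZm mulNr; congr (_ - _ * _).
    rewrite /qf mulmxA -mulmxA mxE big_ord1 wE -[w *m _]trmxK trmx_mul trmxK mxE wE.
    by rewrite expr2.
  by rewrite subr_ge0 mulrC ler_pdivrMr // psd_CS.
have uA' : u *m A' = 0.
  rewrite mulmxBr -scalemxAr mulmxA [u *m w^T]mx11_scalar wE mul_scalar_mx scalerA.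
  by rewrite mulVf // scale1r subrr.
(* [u] lies in the kernel of [A'] but not in that of [A]. *)
have rA' : (\rank A' < \rank A)%N.
  have sub : (A' <= A)%MS.
    by rewrite addmx_sub // -scaleNr scalemx_sub // /w mulmxA submxMl.
  rewrite ltnNge; apply/negP => rk.
  have /submxP[D AD] : (A <= A')%MS by rewrite -(mxrank_leqif_sup sub) eqn_leq mxrankS.
  have : u *m A = 0.
    have sA' := ((psdP A').1 hA').1.
    by rewrite -[u *m A]trmxK trmx_mul sA AD -mulmxA -sA' -trmx_mul uA' trmx0 mulmx0 trmx0.
  by move=> uA; move: q0; rewrite /qf uA mul0mx mxE ltxx.
have -> : A = A' + (qf A u)^-1 *: (w^T *m w) by rewrite subrK.
rewrite mulmxDl linearD addr_ge0 //=; first by apply: IH => //; exact: leq_trans rA' _.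
rewrite -scalemxAl linearZ /= mulr_ge0 ?invr_ge0 // -mulmxA mxtrace_mulC.
by rewrite [mxtrace _]big_ord1; exact: qB.
Qed.

End PSD.

(** * Compactness, the Lyapunov equation and Finsler's lemma *)

Section Analysis.
Variable R : realType.

Lemma pd_unit n (A : 'M[R]_n) : pd A -> A \in unitmx.
Proof.
move=> [_ hA]; rewrite -row_free_unit -kermx_eq0; apply/rowV0P => u /sub_kermxP uA.
by apply: contraTeq isT => /hA; rewrite /qf uA mul0mx mxE ltxx.
Qed.

Lemma psd_pd n (A : 'M[R]_n) : psd A -> (forall u : 'rV_n, u *m A = 0 -> u = 0) -> pd A.
Proof.
move=> hA hu; have [sA qA] := (psdP A).1 hA; split=> // u u0.
by rewrite lt_def qA andbT; apply: contra_neq u0 => /(psd_ker hA)/hu.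
Qed.

(** The Lyapunov operator of [X], twice the Jordan product. For symmetric arguments the value is
    symmetric again, unlike [X *m Z]. *)
Definition jordan n (X Z : 'M[R]_n) : 'M[R]_n := X *m Z + Z *m X.

(** Multiplying by [Y^T] and taking the trace gives a sum of values of [X] at the rows of [Y^T] and
    of [Y], all nonnegative. *)
Lemma jordan_inj n (X Y : 'M[R]_n) : pd X -> jordan X Y = 0 -> Y = 0.
Proof.
move=> hX e; have [sX qX] := hX.
have trE (B : 'M[R]_n) : \tr (B *m X *m B^T) = \sum_i qf X (row i B).
  by apply: eq_bigr => i _; rewrite /qf -row_mul !mxE; apply: eq_bigr => j _; rewrite !mxE.
have qX0 u : 0 <= qf X u by case: ((psdP X).1 (pd_psd hX)).
have : \tr (Y^T *m X *m Y^T^T) + \tr (Y *m X *m Y^T) = 0.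
  rewrite trmxK [\tr (Y *m X *m Y^T)]mxtrace_mulC -mulmxA -mxtraceD -mulmxDr.
  by rewrite -/(jordan X Y) e mulmx0 mxtrace0.
rewrite !trE => /eqP; rewrite paddr_eq0 ?sumr_ge0 // => /andP[_ /eqP].
move=> /psumr_eq0P h; apply/row_matrixP => i; rewrite row0.
by apply/eqP; apply: contraT => /qX; rewrite h ?ltxx.
Qed.

(** Injectivity on all square matrices gives surjectivity by dimension. The solution is symmetric
    because its transpose solves the same equation. *)
Lemma jordan_surj n (X W : 'M[R]_n) : pd X -> W^T = W ->
  exists Y, Y^T = Y /\ jordan X Y = W.
Proof.
move=> hX sW; have [sX _] := hX.
pose L : 'M[R]_(n * n) := lin_mulmx X + lin_mulmxr X.
have LE Y : mxvec Y *m L = mxvec (jordan X Y).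
  by rewrite mulmxDr !mul_vec_lin /= -linearD.
have uL : L \in unitmx.
  rewrite -row_free_unit -kermx_eq0; apply/rowV0P => u /sub_kermxP.
  rewrite -[u]vec_mxK LE => /eqP; rewrite mxvec_eq0 => /eqP /(jordan_inj hX) ->.
  by rewrite linear0.
pose Y := vec_mx (mxvec W *m invmx L).
have YW : jordan X Y = W.
  by apply: (can_inj mxvecK); rewrite -LE vec_mxK mulmxKV.
exists Y; split => //; apply/eqP; rewrite -subr_eq0; apply/eqP.
apply: (jordan_inj hX); rewrite /jordan mulmxBr mulmxBl addrACA -opprD.
rewrite -/(jordan X Y) YW -[in X in _ - X]sW -YW /jordan linearD /= !trmx_mul sX.
by rewrite addrC subrr.
Qed.

Lemma rV_attains_min n (A : set 'rV[R]_n) (f : 'rV[R]_n -> R) B :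
  A !=set0 -> closed A -> (forall x, A x -> forall i, `|x 0 i| <= B) -> continuous f ->
  exists2 c, A c & forall x, A x -> f c <= f x.
Proof.
move=> A0 Acl hB cf.
have cbox : compact [set v : 'rV[R]_n | forall i, v ord0 i \in `[(- B), B]].
  apply: (@rV_compact _ _ (fun=> `[(- B), B]%classic)) => _; exact: segment_compact.
have cA : compact A.
  apply: subclosed_compact Acl cbox _ => x /hB h i.
  by rewrite in_itv /= -ler_norml h.
have [c /set_mem Ac h] := EVT_min_rV A0 cA (continuous_subspaceT cf).
by exists c => // x Ax; apply: h; exact/mem_set.
Qed.

Lemma cont_sum (T : topologicalType) I (r : seq I) (F : I -> T -> R) :
  (forall i, continuous (F i)) -> continuous (fun x => \sum_(i <- r) F i x).
Proof.
move=> h x; elim: r => [|i r IH].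
  by under eq_fun do rewrite big_nil; exact: cvg_cst.
under eq_fun do rewrite big_cons.
by apply: cvgD => //; exact: h.
Qed.

Lemma cont_prod (T : topologicalType) I (r : seq I) (F : I -> T -> R) :
  (forall i, continuous (F i)) -> continuous (fun x => \prod_(i <- r) F i x).
Proof.
move=> h x; elim: r => [|i r IH].
  by under eq_fun do rewrite big_nil; exact: cvg_cst.
under eq_fun do rewrite big_cons.
by apply: cvgM => //; exact: h.
Qed.

Lemma cont_mulr (T : topologicalType) (F G : T -> R) :
  continuous F -> continuous G -> continuous (fun x => F x * G x).
Proof. by move=> hF hG x; apply: cvgM; [exact: hF|exact: hG]. Qed.

Lemma cont_qf n (A : 'M[R]_n) : continuous (qf A).
Proof.
have -> : qf A = fun u => \sum_j (\sum_i u 0 i * A i j) * u 0 j.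
  apply/funext => u; rewrite /qf mxE; apply: eq_bigr => j _.
  by rewrite !mxE.
apply: cont_sum => j; apply: cont_mulr; last exact: coord_continuous.
apply: cont_sum => i; apply: cont_mulr; first exact: coord_continuous.
exact: cst_continuous.
Qed.

Lemma closed_ge0 (T : topologicalType) (f : T -> R) :
  continuous f -> closed [set x | 0 <= f x].
Proof. by move=> cf; apply: (@preimage_closed _ _ f [set y | 0 <= y]) => [x _|]; [exact: cf|exact: closed_ge]. Qed.

Lemma closed_eq_cst (T : topologicalType) (f : T -> R) y :
  continuous f -> closed [set x | f x = y].
Proof. by move=> cf; apply: (@preimage_closed _ _ f [set z | z = y]) => [x _|]; [exact: cf|exact: closed_eq]. Qed.

Lemma sphere_coord n (u : 'rV[R]_n) i : qf 1%:M u = 1 -> `|u 0 i| <= 1.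
Proof.
move=> u1; rewrite -ler_sqr ?nnegrE // expr1n -normrX ger0_norm ?sqr_ge0 // -u1 qf1.
by rewrite (bigD1 i) //= lerDl sumr_ge0 // => j _; rewrite sqr_ge0.
Qed.

Lemma sphere_scale n (u : 'rV[R]_n) : u != 0 ->
  exists2 a, 0 < a & qf 1%:M (a *: u) = 1.
Proof.
move=> /qf1_gt0 u0; exists (Num.sqrt (qf 1%:M u))^-1.
  by rewrite invr_gt0 sqrtr_gt0.
by rewrite qfZ exprVn sqr_sqrtr ?mulVf ?gt_eqF // ltW.
Qed.

(** Compactness: on the part of the unit sphere where [X] is nonpositive, [Y] has a positive
    minimum, and [l] makes it outweigh the least value of [X] on the sphere. *)
Lemma finsler n (X Y : 'M[R]_n) : X^T = X -> psd Y ->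
  (forall u : 'rV_n, u != 0 -> u *m Y = 0 -> 0 < qf X u) ->
  exists2 l, 0 <= l & psd (X + l *: Y).
Proof.
move=> sX hY hXY; have [sY qY] := (psdP Y).1 hY.
pose S := [set u : 'rV[R]_n | qf 1%:M u = 1].
have clS : closed S by apply: closed_eq_cst; exact: cont_qf.
have reduce l : (forall u, S u -> 0 <= qf (X + l *: Y) u) -> psd (X + l *: Y).
  move=> h; rewrite psdP; split; first by rewrite linearD linearZ /= sX sY.
  move=> u; have [->|u0] := eqVneq u 0; first by rewrite /qf !mul0mx mxE.
  have [a a0 Sa] := sphere_scale u0; have := h _ Sa.
  by rewrite qfZ pmulr_rge0 // exprn_gt0.
pose A := S `&` [set u | 0 <= - qf X u].
have [A0|A0] := pselect (A !=set0); last first.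
  exists 0 => //; apply: reduce => u Su; rewrite scale0r addr0 leNgt; apply/negP => q0.
  have Au : A u by split=> //=; rewrite oppr_ge0 ltW.
  by apply: A0; exists u.
have cX : continuous (fun u => - qf X u).
  move=> u; apply: (@continuousN _ _ _ (qf X)); exact: cont_qf.
have clA : closed A by apply: closedI => //; exact: closed_ge0.
have [u1 [Su1 qu1] min1] := @rV_attains_min _ A (qf Y) 1 A0 clA
  (fun u Au i => sphere_coord i Au.1) (@cont_qf _ Y).
have [u2 Su2 min2] := @rV_attains_min _ S (qf X) 1 (ex_intro _ u1 Su1) clS
  (fun u Su i => sphere_coord i Su) (@cont_qf _ X).
have u1n : u1 != 0.
  by apply: contra_eq_neq Su1 => ->; rewrite /qf !mul0mx mxE eq_sym oner_eq0.
have mu0 : 0 < qf Y u1.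
  rewrite lt_def qY andbT; apply/negP => /eqP /(psd_ker hY) /(hXY _ u1n).
  by rewrite ltNge -oppr_ge0 qu1.
exists (`|qf X u2| / qf Y u1); first by rewrite divr_ge0.
apply: reduce => u Su; rewrite qfDm qfZm.
have [q0|q0] := leP 0 (qf X u); first by rewrite addr_ge0 // mulr_ge0 // divr_ge0.
have Au : A u by split => //=; rewrite oppr_ge0 ltW.
rewrite -[X in X <= _](subrr `|qf X u2|) [X in X <= _]addrC lerD //.
  by rewrite (le_trans _ (min2 _ Su)) // lerNl -normrN ler_norm.
by rewrite mulrAC ler_pdivlMr // ler_wpM2l // min1.
Qed.

Lemma pd_scale_ge n (X A : 'M[R]_n) : X^T = X -> pd A ->
  exists2 l, 0 < l & pd (X + l *: A).
Proof.
move=> sX hA; have [|l l0 hl] := finsler sX (pd_psd hA).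
  move=> u u0 uA; have [_ /(_ _ u0)] := hA.
  by rewrite /qf uA mul0mx mxE ltxx.
exists (l + 1); first exact: ltr_wpDl.
by rewrite scalerDl scale1r addrA addrC; apply: pdDl.
Qed.

End Analysis.

(** * Central points *)

Section CentralPoint.
Variable R : realType.

(** This is the reversed characteristic polynomial of [- A], whose second coefficient is the trace.
    The remainder is kept as a polynomial so that it can be bounded near 0. *)
Lemma det_expansion n (A : 'M[R]_n) : exists q : {poly R}, forall t,
  \det (1%:M + t *: A) = 1 + t * \tr A + t ^+ 2 * q.[t].
Proof.
case: n A => [|n] A.
  by exists 0 => t; rewrite det_mx00 horner0 /mxtrace big_ord0 !mulr0 !addr0.
pose c i := (char_poly (- A))`_i.
have cn : c n.+1 = 1.
  have := char_poly_monic (- A); rewrite monicE /lead_coef size_char_poly => /eqP.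
  by [].
have cn1 : c n = \tr A by rewrite /c char_poly_trace //= linearN opprK.
have hE t : \det (1%:M + t *: A) = \sum_(i < n.+2) c i * t ^+ (n.+1 - i).
  have [->|t0] := eqVneq t 0.
    rewrite scale0r addr0 det1 big_ord_recr /= cn subnn expr0 mul1r big1 ?add0r // => i _.
    by rewrite expr0n subn_eq0 leqNgt ltn_ord mulr0.
  have -> : 1%:M + t *: A = t *: (t^-1%:M + A).
    by rewrite scalerDr scale_scalar_mx divff.
  rewrite detZ.
  have -> : \det (t^-1%:M + A) = (char_poly (- A)).[t^-1].
    rewrite /char_poly -horner_evalE -det_map_mx; congr (\det _).
    by apply/matrixP => i j; rewrite !mxE /= horner_evalE hornerD hornerN hornerMn hornerX hornerC opprK.
  rewrite (@horner_coef_wide _ n.+2) ?size_char_poly // mulr_sumr.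
  apply: eq_bigr => i _; rewrite mulrCA; congr (_ * _).
  have ile : (i <= n.+1)%N by rewrite -ltnS.
  by rewrite -{1}(subnK ile) exprD exprVn mulfK ?expf_neq0.
exists (\sum_(i < n) (c i *: 'X^(n.-1 - i))) => t; rewrite hE.
rewrite big_ord_recr big_ord_recr /= subnn subSnn expr0 expr1 cn cn1 mulr1 [LHS]addrC.
rewrite -[RHS]addrA; congr (_ + _); rewrite [LHS]addrC [\tr A * t]mulrC; congr (_ + _).
rewrite horner_sum mulr_sumr; apply: eq_bigr => i _.
rewrite hornerZ hornerXn mulrCA -exprD; congr (_ * _ ^+ _).
by have := ltn_ord i; lia.
Qed.

(** If the trace [a] were nonzero, moving by [t = b a] with a small [b > 0] would gain [b a ^+ 2] to
    first order. *)
Lemma mxtrace0_of_local_max n (A : 'M[R]_n) d : 0 < d ->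
  (forall t, `|t| <= d -> \det (1%:M + t *: A) <= 1) -> \tr A = 0.
Proof.
move=> d0 h; have [q qE] := det_expansion A.
pose K := \sum_(i < size q) `|q`_i|.
have qK t : `|t| <= 1 -> `|q.[t]| <= K.
  move=> t1; rewrite horner_coef (le_trans (ler_norm_sum _ _ _)) // ler_sum // => i _.
  by rewrite normrM ler_piMr // normrX exprn_ile1.
have K0 : 0 <= K by rewrite sumr_ge0.
apply/eqP/negPn/negP => a0; set a := \tr A in a0 *.
(* The factor [1 + |a|] keeps [b a] within the allowed range; the factor [1 + K] gives [b K < 1], so
   the quadratic remainder cannot cancel the gain. *)
pose b := Num.min d 1 / ((1 + `|a|) * (1 + K)).
have m0 : 0 < Num.min d 1 by rewrite lt_min d0 ltr01.
have den : 0 < (1 + `|a|) * (1 + K) by rewrite mulr_gt0 // ltr_pwDl.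
have b0 : 0 < b by rewrite divr_gt0.
have bm : b * (1 + `|a|) * (1 + K) = Num.min d 1 by rewrite /b -mulrA divfK ?gt_eqF.
have bam : b * (1 + `|a|) <= Num.min d 1.
  by rewrite -bm; apply: ler_peMr; [rewrite mulr_ge0 ?(ltW b0) // addr_ge0 | rewrite lerDl].
have tm : `|b * a| <= Num.min d 1.
  rewrite normrM gtr0_norm // (le_trans _ bam) // ler_pM2l // lerDr //.
have td : `|b * a| <= d by rewrite (le_trans tm) // ge_min lexx.
have t1 : `|b * a| <= 1 by rewrite (le_trans tm) // ge_min lexx orbT.
have bK : b * K < 1.
  have : b * (1 + K) <= 1.
    rewrite (@le_trans _ _ (b * (1 + `|a|) * (1 + K))) //; last by rewrite bm ge_min lexx orbT.
    by rewrite ler_pM2r ?ltr_pwDl //; apply: ler_peMr; [exact: ltW | rewrite lerDl].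
  by apply: lt_le_trans; rewrite ltr_pM2l // ltrDr.
have := h _ td; rewrite qE -/a -addrA gerDl leNgt => /negP; apply.
have a2 : 0 < a ^+ 2 by rewrite exprn_even_gt0.
have -> : b * a * a + (b * a) ^+ 2 * q.[b * a] = b * a ^+ 2 * (1 + b * q.[b * a]) by ring.
apply: mulr_gt0; first exact: mulr_gt0.
have := qK _ t1; rewrite ler_norml => /andP[qK1 _].
have : b * - K <= b * q.[b * a] by rewrite ler_pM2l.
rewrite mulrN; move: bK; move: (b * K) (b * q.[b * a]) => u v ? ?; lra.
Qed.

(** The largest eigenvalue is at most the trace; instead of spectral theory, [X] is paired with the
    psd matrix [|v|^2 I - v^T v]. *)
Lemma psd_qf_le_trace n (X : 'M[R]_n) v : psd X -> qf X v <= \tr X * qf 1%:M v.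
Proof.
move=> hX; pose V := qf 1%:M v *: 1%:M - v^T *m v.
have psd1 : psd (1%:M : 'M[R]_n).
  by rewrite psdP trmx1; split => // u; exact: qf1_ge0.
have hV : psd V.
  rewrite psdP; split; first by rewrite linearB linearZ /= trmx1 trmx_mul trmxK.
  move=> w; have -> : qf V w = qf 1%:M v * qf 1%:M w - bf 1%:M v w ^+ 2.
    rewrite qfDm qfZm; congr (_ + _); rewrite /qf mulmxN mulNmx mxE; congr (- _).
    have e1 : (v *m w^T) 0 0 = bf 1%:M v w by rewrite /bf mulmx1.
    have e2 : (w *m v^T) 0 0 = bf 1%:M v w by rewrite bfC ?trmx1 // /bf mulmx1.
    by rewrite mulmxA -mulmxA mxE big_ord1 e1 e2 expr2.
  by rewrite subr_ge0 psd_CS.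
have := psd_mxtrace_mul hX hV; rewrite mulmxBr linearB /= -scalemxAr mulmx1 linearZ /=.
rewrite subr_ge0 mulrC; apply: le_trans.
by rewrite mulmxA mxtrace_mulC mulmxA /qf [leRHS]big_ord1.
Qed.

(** [X^2 <= X] because the eigenvalues are at most 1; Cauchy-Schwarz for [w] and [w *m X] takes the
    place of the spectral argument. *)
Lemma psd_sq_le n (X : 'M[R]_n) w : psd X -> \tr X = 1 -> qf 1%:M (w *m X) <= qf X w.
Proof.
move=> hX t1; have [sX qX] := (psdP X).1 hX.
have [->|a0] := eqVneq (qf 1%:M (w *m X)) 0; first exact: qX.
have {}a0 : 0 < qf 1%:M (w *m X) by rewrite lt_def a0 qf1_ge0.
have := psd_CS w (w *m X) hX.
have -> : bf X w (w *m X) = qf 1%:M (w *m X) by rewrite /bf /qf mulmx1.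
move=> h; rewrite -(ler_pM2r a0) -expr2 (le_trans h) // ler_wpM2l //.
by have := psd_qf_le_trace (w *m X) hX; rewrite t1 mul1r.
Qed.

Lemma pd_trace_gt0 n (X : 'M[R]_n) : (0 < n)%N -> pd X -> 0 < \tr X.
Proof.
case: n X => // n X _ hX; rewrite /mxtrace (bigD1 ord0) //= ltr_pwDl //.
  rewrite -qf_delta; apply: hX.2; apply/rV0Pn; exists ord0; rewrite mxE eqxx oner_eq0 //.
by rewrite sumr_ge0 // => i _; apply: psd_diag; apply: pd_psd.
Qed.

End CentralPoint.

Section CentralPoint.
Variable R : realType.

Lemma cont_det (T : topologicalType) n (F : T -> 'M[R]_n) :
  (forall i j, continuous (fun x => F x i j)) -> continuous (fun x => \det (F x)).
Proof.
move=> h; apply: cont_sum => s; apply: cont_mulr; first exact: cst_continuous.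
by apply: cont_prod => i; exact: h.
Qed.

(** For [0 <= t] and [t * l <= 1] this is a nonnegative combination, so [X + t *: Y] is psd when [X]
    and [Y + l *: X] are. Using it for [Y] and [- Y] covers both directions from [X]. *)
Lemma line_comb n (X Y : 'M[R]_n) t l :
  X + t *: Y = t *: (Y + l *: X) + (1 - t * l) *: X.
Proof. by apply/matrixP => i j; rewrite !mxE; ring. Qed.

Variables (N m : nat) (B : 'I_N -> 'M[R]_m).
Hypothesis symB : forall i, (B i)^T = B i.

Definition mxcomb (x : 'rV[R]_N) : 'M[R]_m := \sum_i x 0 i *: B i.

Lemma mxcombD x y : mxcomb (x + y) = mxcomb x + mxcomb y.
Proof. by rewrite /mxcomb -big_split; apply: eq_bigr => i _; rewrite mxE scalerDl. Qed.

Lemma mxcombZ a x : mxcomb (a *: x) = a *: mxcomb x.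
Proof. by rewrite /mxcomb scaler_sumr; apply: eq_bigr => i _; rewrite mxE scalerA. Qed.

Lemma mxcomb_sym x : (mxcomb x)^T = mxcomb x.
Proof. by rewrite /mxcomb linear_sum; apply: eq_bigr => i _; rewrite linearZ /= symB. Qed.

Lemma mxcomb_delta i : mxcomb (delta_mx 0 i) = B i.
Proof.
rewrite /mxcomb (bigD1 i) //= mxE !eqxx scale1r big1 ?addr0 // => j ji.
by rewrite mxE eqxx (negPf ji) scale0r.
Qed.

Lemma cont_mxcomb i j : continuous (fun x => mxcomb x i j).
Proof.
have -> : (fun x => mxcomb x i j) = fun x : 'rV[R]_N => \sum_k x 0 k * B k i j.
  by apply/funext => x; rewrite summxE; apply: eq_bigr => k _; rewrite mxE.
apply: cont_sum => k; apply: cont_mulr; last exact: cst_continuous.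
exact: coord_continuous.
Qed.

Lemma closed_psd_mxcomb : closed [set x | psd (mxcomb x)].
Proof.
have -> : [set x | psd (mxcomb x)] = \bigcap_(u in setT) [set x | 0 <= qf (mxcomb x) u].
  apply/seteqP; split => x /=; rewrite psdP; first by move=> [_ h] u _; exact: h.
  by move=> h; split; [exact: mxcomb_sym | move=> u; exact: h].
apply: closed_bigI => u _; apply: closed_ge0.
have -> : (fun x => qf (mxcomb x) u) =
    fun x => \sum_j (\sum_i u 0 i * mxcomb x i j) * u 0 j.
  by apply/funext => x; rewrite /qf mxE; apply: eq_bigr => j _; rewrite !mxE.
apply: cont_sum => j; apply: cont_mulr; last exact: cst_continuous.
by apply: cont_sum => i; apply: cont_mulr; [exact: cst_continuous|exact: cont_mxcomb].
Qed.

Definition pairing (zeta x : 'rV[R]_N) : R := \sum_i x 0 i * zeta 0 i.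

Lemma pairingD zeta x y : pairing zeta (x + y) = pairing zeta x + pairing zeta y.
Proof. by rewrite -big_split; apply: eq_bigr => i _; rewrite mxE mulrDl. Qed.

Lemma pairingZ zeta a x : pairing zeta (a *: x) = a * pairing zeta x.
Proof. by rewrite mulr_sumr; apply: eq_bigr => i _; rewrite mxE mulrA. Qed.

Lemma pairing_delta zeta i : pairing zeta (delta_mx 0 i) = zeta 0 i.
Proof.
rewrite /pairing (bigD1 i) //= mxE !eqxx mul1r big1 ?addr0 // => j ji.
by rewrite mxE eqxx (negPf ji) mul0r.
Qed.

Lemma cont_pairing zeta : continuous (pairing zeta).
Proof.
apply: cont_sum => k; apply: cont_mulr; last exact: cst_continuous.
exact: coord_continuous.
Qed.

Variables (C : R) (x1 : 'rV[R]_N).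
Hypothesis m_gt0 : (0 < m)%N.
Hypothesis pd1 : pd (mxcomb x1).
Hypothesis coord_bound : forall x, psd (mxcomb x) -> forall i, `|x 0 i| <= C * \tr (mxcomb x).

(* [X = mxcomb x] is proportional to the maximizer of the determinant on the
   slice [pairing zeta = 1], where the gradient [X^-1] is proportional to [zeta]. *)
Lemma central_point zeta eps d x0 : 0 < eps ->
  (forall x, psd (mxcomb x) -> eps * \tr (mxcomb x) <= pairing zeta x) ->
  psd (mxcomb x0) -> 0 < \tr (mxcomb x0) -> pairing zeta x0 <= d * \tr (mxcomb x0) ->
  exists x Z s, [/\ pd (mxcomb x) /\ \tr (mxcomb x) = 1, Z^T = Z,
    mxcomb x *m Z = s%:M /\ Z *m mxcomb x = s%:M,
    forall i, \tr (B i *m Z) = zeta 0 i & eps / m%:R <= s <= d].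
Proof.
move=> eps0 heps psd0 tr0 hd.
pose A := [set x | psd (mxcomb x)] `&` [set x | pairing zeta x = 1].
have clA : closed A.
  by apply: closedI; [exact: closed_psd_mxcomb | apply: closed_eq_cst; exact: cont_pairing].
have boundA x : A x -> forall i, `|x 0 i| <= C / eps.
  move=> [/= hx fx] i; rewrite (le_trans (coord_bound hx i)) // ler_wpM2l //.
    rewrite -(@pmulr_lge0 _ (\tr (mxcomb x1))) ?pd_trace_gt0 //.
    exact: le_trans (normr_ge0 _) (coord_bound (pd_psd pd1) i).
  by rewrite -[eps^-1]mul1r ler_pdivlMr // mulrC -fx heps.
have f1 : 0 < pairing zeta x1.
  by rewrite (lt_le_trans _ (heps _ (pd_psd pd1))) // mulr_gt0 // pd_trace_gt0.
pose x1' := (pairing zeta x1)^-1 *: x1.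
have pd1' : pd (mxcomb x1') by rewrite mxcombZ; apply: pdZ; rewrite ?invr_gt0.
have Ax1 : A x1' by split; [exact: pd_psd | rewrite /= pairingZ mulVf ?gt_eqF].
(* Squaring makes the sign of the determinant irrelevant; the minimizer maximizes its absolute
   value. *)
have cdet : continuous (fun x => - (\det (mxcomb x) * \det (mxcomb x))).
  move=> x; apply: (@continuousN _ _ _ (fun x => \det (mxcomb x) * \det (mxcomb x))).
  by apply: cont_mulr; apply: cont_det => i j; exact: cont_mxcomb.
have [x [hx fx] xmax] := rV_attains_min (ex_intro _ _ Ax1) clA boundA cdet.
set X := mxcomb x in hx xmax.
have detX : \det X != 0.
  have := xmax _ Ax1; rewrite lerN2 => h; apply: contraTneq h => ->.
  rewrite mul0r -ltNge -expr2 exprn_even_gt0 //= -unitfE -unitmxE.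
  exact: pd_unit.
have uX : X \in unitmx by rewrite unitmxE unitfE.
have pdX : pd X.
  by apply: psd_pd => // u /(congr1 (mulmx^~ (invmx X))); rewrite mulmxK // mul0mx.
have sX := mxcomb_sym x; rewrite -/X in sX.
have grad0 y : pairing zeta y = 0 -> \tr (invmx X *m mxcomb y) = 0.
  move=> fy; set Y := mxcomb y.
  have sY := mxcomb_sym y; rewrite -/Y in sY.
  have [l1 l10 hl1] := pd_scale_ge sY pdX.
  have sNY : (- Y)^T = - Y by rewrite linearN /= sY.
  have [l2 l20 hl2] := pd_scale_ge sNY pdX.
  have l0 : 0 < l1 + l2 by rewrite addr_gt0.
  apply: (@mxtrace0_of_local_max _ _ _ (l1 + l2)^-1); first by rewrite invr_gt0.
  move=> t ht.
  have psdt : psd (X + t *: Y).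
    have tl : `|t| * (l1 + l2) <= 1 by rewrite -ler_pdivlMr // mul1r.
    have [t0|t0] := leP 0 t.
      rewrite (line_comb X Y t l1).
      apply: psdD; first by apply: psdZ => //; apply: pd_psd.
      apply: psdZ; last exact: pd_psd.
      rewrite subr_ge0 (le_trans _ tl) // ger0_norm // ler_wpM2l // lerDl ltW //.
    have := line_comb X (- Y) (- t) l2; rewrite scalerN scaleNr opprK mulNr opprK => ->.
    apply: psdD; first by apply: psdZ; rewrite ?oppr_ge0 ?(ltW t0) //; apply: pd_psd.
    apply: psdZ; last exact: pd_psd.
    rewrite -(opprK (t * l2)) -mulNr subr_ge0 (le_trans _ tl) // ltr0_norm // ler_wpM2l //.
      by rewrite oppr_ge0 ltW.
    by rewrite lerDr ltW.
  have Axt : A (x + t *: y).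
    by split; rewrite /= ?mxcombD ?mxcombZ // pairingD pairingZ fy mulr0 addr0.
  have := xmax _ Axt; rewrite lerN2 mxcombD mxcombZ -/X -/Y.
  have -> : X + t *: Y = X *m (1%:M + t *: (invmx X *m Y)).
    by rewrite mulmxDr mulmx1 -scalemxAr mulmxA mulmxV // mul1mx.
  rewrite det_mulmx mulrACA -!expr2 -[leRHS]mulr1 ler_pM2l ?exprn_even_gt0 //.
  by rewrite -[leRHS](expr1n _ 2) => h; rewrite (le_trans (ler_norm _)) // -ler_sqr
    ?nnegrE // real_normK ?num_real.
(* Projecting [y] along [x] to the hyperplane [pairing zeta = 0] leaves only the multiplier, which
   the trace [m] of the identity determines. *)
have grad y : \tr (invmx X *m mxcomb y) = pairing zeta y * m%:R.
  have := grad0 (y - pairing zeta y *: x).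
  rewrite -scaleNr pairingD pairingZ fx mulr1 subrr => /(_ erefl).
  rewrite mxcombD mxcombZ scaleNr mulmxBr linearB /= -scalemxAr mulVmx // linearZ /=.
  by rewrite mxtrace1 => /eqP; rewrite subr_eq0 => /eqP.
have mR : 0 < m%:R :> R by rewrite ltr0n.
have T0 := pd_trace_gt0 m_gt0 pdX; set T := \tr X in T0.
pose s := (T * m%:R)^-1.
have s0 : 0 < s by rewrite invr_gt0 mulr_gt0.
(* The factor [1 / m] turns the gradient identity into [\tr (B i *m Z) = zeta 0 i]. *)
pose Z := m%:R^-1 *: invmx X.
exists (T^-1 *: x), Z, s.
have pdX' : pd (mxcomb (T^-1 *: x)) by rewrite mxcombZ; apply: pdZ; rewrite ?invr_gt0.
have tr1 : \tr (mxcomb (T^-1 *: x)) = 1.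
  by rewrite mxcombZ linearZ /= -/T mulVf ?gt_eqF.
have sZ : Z^T = Z by rewrite linearZ /= trmx_inv sX.
have XZ : mxcomb (T^-1 *: x) *m Z = s%:M.
  by rewrite mxcombZ -scalemxAl -scalemxAr mulmxV // scalerA scalemx1 /s invfM.
have ZX : Z *m mxcomb (T^-1 *: x) = s%:M.
  by rewrite mxcombZ -scalemxAl -scalemxAr mulVmx // scalerA scalemx1 /s invfM mulrC.
have pairZ y : \tr (mxcomb y *m Z) = pairing zeta y.
  by rewrite -scalemxAr linearZ /= mxtrace_mulC grad mulrC mulfK ?gt_eqF.
split => //.
  by move=> i; rewrite -mxcomb_delta pairZ pairing_delta.
apply/andP; split.
  (* On the slice [1 = pairing zeta x >= eps * T], hence the lower bound. *)
  rewrite /s invfM ler_pM2r ?invr_gt0 // -[T^-1]mul1r ler_pdivlMr //.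
  by rewrite (le_trans (heps _ hx)) // fx.
(* [X' = s Z^-1] has trace one, so it is at most [I] and [Z] is at least [s I]. Testing this against
   [x0] gives [s <= d]. *)
have psdZs : psd (Z - s%:M).
  rewrite psdP; split; first by rewrite linearB /= sZ tr_scalar_mx.
  move=> u; rewrite -scalemx1 -scaleNr qfDm (qfZm (- s)) mulNr subr_ge0.
  have uX' := pd_unit pdX'; set X' := mxcomb _ in pdX' tr1 XZ ZX uX'.
  pose w := s^-1 *: (u *m Z).
  have wu : w *m X' = u.
    by rewrite -scalemxAl -mulmxA ZX mul_mx_scalar scalerA mulVf ?gt_eqF // scale1r.
  have -> : qf Z u = s * qf X' w.
    rewrite [in RHS]/qf wu /w linearZ /= -scalemxAr trmx_mul sZ mulmxA mxE mulrA.
    by rewrite divff ?mul1r ?gt_eqF.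
  by rewrite ler_pM2l // -{1}wu; apply: psd_sq_le => //; exact: pd_psd.
have := psd_mxtrace_mul psd0 psdZs.
rewrite mulmxBr linearB /= pairZ mul_mx_scalar linearZ /= subr_ge0 => h.
by rewrite -(ler_pM2r tr0) (le_trans h).
Qed.

End CentralPoint.

(** * Coordinates of symmetric matrices *)

Section SymCoordinates.
Variables (R : realType) (m : nat).

Definition upper := [pred ij : 'I_m * 'I_m | (ij.1 <= ij.2)%N].

Lemma in_upper ij : (ij \in upper) = (ij.1 <= ij.2)%N.
Proof. by []. Qed.

Lemma card_upper : #|upper| = 'C(m.+1, 2).
Proof.
rewrite -sum1_card -(pair_big_dep xpredT (fun i j : 'I_m => (i <= j)%N) (fun _ _ => 1%N)) /=.
rewrite (exchange_big_dep xpredT) //= -bin2_sum big_mkord big_ord_recl add0n.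
apply: eq_bigr => j _ /=; rewrite /bump add1n.
rewrite -[RHS]card_ord -sum1_card (big_ord_widen m (fun=> 1%N)) //.
Qed.

Definition coord_sym (X : 'M[R]_m) (l : 'I_#|upper|) : R :=
  X (enum_val l).1 (enum_val l).2.

(** The disjunction gives a diagonal unit the entry 1 rather than 2, so that [of_coord] inverts
    [coord_sym]. *)
Definition unit_sym (l : 'I_#|upper|) : 'M[R]_m :=
  \matrix_(i, j) ((enum_val l == (i, j)) || (enum_val l == (j, i)))%:R.

Lemma unit_sym_sym l : (unit_sym l)^T = unit_sym l.
Proof. by apply/matrixP => i j; rewrite !mxE orbC. Qed.

Definition of_coord (z : 'I_#|upper| -> R) : 'M[R]_m := \sum_l z l *: unit_sym l.

Lemma of_coord_sym z : (of_coord z)^T = of_coord z.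
Proof. by rewrite linear_sum; apply: eq_bigr => l _; rewrite linearZ /= unit_sym_sym. Qed.

Lemma of_coordE z i j (hij : (i, j) \in upper) : of_coord z i j = z (enum_rank_in hij (i, j)).
Proof.
rewrite summxE (bigD1 (enum_rank_in hij (i, j))) //= !mxE enum_rankK_in // eqxx mulr1.
rewrite big1 ?addr0 // => l ll; rewrite !mxE; case: eqP => [e|ne /=].
  by case/eqP: ll; apply: enum_val_inj; rewrite enum_rankK_in.
case: eqP => [e|_]; last by rewrite mulr0.
have ji := enum_valP l; rewrite e in_upper /= in ji; case: ne; rewrite e.
have ij : (i <= j)%N by have := hij; rewrite in_upper.
have -> // : i = j; apply/val_inj/eqP.
by rewrite eqn_leq ij.
Qed.

Lemma of_coordK z : coord_sym (of_coord z) =1 z.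
Proof.
move=> l; rewrite /coord_sym; have := enum_valP l; case e : (enum_val l) => [i j] /= hij.
by rewrite of_coordE -{2}e enum_valK_in.
Qed.

Lemma sym_upper_inj (X Y : 'M[R]_m) : X^T = X -> Y^T = Y ->
  coord_sym X =1 coord_sym Y -> X = Y.
Proof.
move=> sX sY h.
have up (i j : 'I_m) : (i <= j)%N -> X i j = Y i j.
  move=> ij; have hij : (i, j) \in upper by rewrite in_upper.
  by have := h (enum_rank_in hij (i, j)); rewrite /coord_sym enum_rankK_in.
apply/matrixP => i j; case: (leqP i j) => [/up //|/ltnW/up e].
by rewrite -sX -sY !mxE.
Qed.

Lemma coord_symK (X : 'M[R]_m) : X^T = X -> of_coord (coord_sym X) = X.
Proof.
move=> sX; apply: sym_upper_inj => //; first exact: of_coord_sym.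
exact: of_coordK.
Qed.

Lemma coord_symD X Y l : coord_sym (X + Y) l = coord_sym X l + coord_sym Y l.
Proof. by rewrite /coord_sym mxE. Qed.

Lemma coord_symZ a X l : coord_sym (a *: X) l = a * coord_sym X l.
Proof. by rewrite /coord_sym mxE. Qed.

Lemma coord_sym_sum I (r : seq I) (F : I -> 'M[R]_m) l :
  coord_sym (\sum_(i <- r) F i) l = \sum_(i <- r) coord_sym (F i) l.
Proof. by rewrite /coord_sym summxE. Qed.

End SymCoordinates.

(** * Families of functionals indexed by matrices *)

Lemma cont_addr (R : realType) (T : topologicalType) (F G : T -> R) :
  continuous F -> continuous G -> continuous (fun x => F x + G x).
Proof. by move=> hF hG x; apply: cvgD; [exact: hF|exact: hG]. Qed.

(** Transports the relation to index types whose sizes are only provably successors. *)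
Lemma polynomial_relation_dim (R : realType) N M n p (eN : N = n.+1) (eM : M = p.+1)
    (G : 'I_N -> 'I_M -> R) (H : 'I_M -> 'I_N -> 'I_M -> R) (T : 'I_N -> R) D E :
  (E <= D)%N ->
  (nmon n E * nmon p D < \sum_(b < E.+1) nmon n (D - b) * nmon p b)%N ->
  exists P : mpoly M (mpoly N R), [/\ P != 0, forall m, (msize (mcoeff m P) <= D.+1)%N &
    forall x z, \sum_i T i * x i = 1 ->
      meval (fun i => \sum_l G i l * z l)
        (meval (fun j => mpolyC N (\sum_i \sum_l H j i l * x i * z l)) P) = 0].
Proof. by subst N M; exact: polynomial_relation. Qed.

Lemma near_one_bounds (R : realType) (y : R) :
  `|y| <= 2^-1 -> 2^-1 <= 1 + y /\ 1 + y <= 3 / 2.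
Proof. by rewrite ler_norml => /andP[? ?]; split; lra. Qed.

Section ConeData.
Variables (R : realType) (k : nat).

(* [L X a v] pairs a matrix [X] with the affine functional [c |-> a + <c, v>]. *)
Definition linear_family m (L : 'M[R]_m -> R -> 'rV[R]_k -> Prop) : Prop :=
  [/\ L 0 0 0,
      forall t X a v Y b w, L X a v -> L Y b w ->
        L (t *: X + Y) (t * a + b) (t *: v + w)
    & forall X a v, L X a v -> X^T = X].

Definition aff (c : 'rV[R]_k) (a : R) (v : 'rV[R]_k) : R := a + \sum_l c 0 l * v 0 l.

Lemma affD c a v b w : aff c (a + b) (v + w) = aff c a v + aff c b w.
Proof.
rewrite /aff addrACA; congr (_ + _); rewrite -big_split.
by apply: eq_bigr => l _; rewrite mxE mulrDr.
Qed.

Lemma affZ c t a v : aff c (t * a) (t *: v) = t * aff c a v.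
Proof.
rewrite /aff mulrDr mulr_sumr; congr (_ + _).
by apply: eq_bigr => l _; rewrite mxE mulrCA.
Qed.

Lemma aff0 c : aff c 0 0 = 0.
Proof. by rewrite /aff add0r big1 // => l _; rewrite mxE mulr0. Qed.

Definition size1 (a : R) (v : 'rV[R]_k) : R := `|a| + \sum_l `|v 0 l|.

Lemma size1_ge0 a v : 0 <= size1 a v.
Proof. by rewrite addr_ge0 // sumr_ge0. Qed.

(* The value zero need not be attained: the values of the functionals at the
   positive semidefinite members of [L] may form a cone that is not closed. *)
Definition tight m (L : 'M[R]_m -> R -> 'rV[R]_k -> Prop) (c : 'rV[R]_k) : Prop :=
  (forall X a v, L X a v -> psd X -> 0 <= aff c a v) /\
  (forall eps, 0 < eps -> exists X a v,
     [/\ L X a v, psd X & aff c a v < eps * size1 a v]).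

Definition eliminable m (L : 'M[R]_m -> R -> 'rV[R]_k -> Prop) : Prop :=
  exists p : mpoly k R, [/\ p != 0, (msize p <= (elimdeg m).+1)%N &
    forall c, tight L c -> meval (fun l => c 0 l) p = 0].

Section Main.
Variables (m : nat) (L : 'M[R]_m -> R -> 'rV[R]_k -> Prop).
Hypothesis linL : linear_family L.

Lemma linear_family_sum N (B : 'I_N -> 'M[R]_m) (al : 'I_N -> R) (pi : 'I_N -> 'rV[R]_k) :
  (forall i, L (B i) (al i) (pi i)) -> forall x : 'rV[R]_N,
  L (mxcomb B x) (\sum_i x 0 i * al i) (\sum_i x 0 i *: pi i).
Proof.
move=> h x; have [L0 LD _] := linL; rewrite /mxcomb.
elim: (index_enum _) => [|i r IH]; first by rewrite !big_nil.
by rewrite !big_cons; apply: LD.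
Qed.

Lemma mul_mxvec_family N (B : 'I_N -> 'M[R]_m) (x : 'rV[R]_N) :
  x *m (\matrix_i mxvec (B i)) = mxvec (mxcomb B x).
Proof.
rewrite mulmx_sum_row /mxcomb linear_sum; apply: eq_bigr => i _.
by rewrite rowK linearZ.
Qed.

Lemma free_familyP N (B : 'I_N -> 'M[R]_m) :
  row_free (\matrix_i mxvec (B i)) <-> forall x, mxcomb B x = 0 -> x = 0.
Proof.
rewrite -kermx_eq0; split=> [/rowV0P h x x0|h].
  by apply: h; apply/sub_kermxP; rewrite mul_mxvec_family x0 linear0.
apply/rowV0P => x /sub_kermxP; rewrite mul_mxvec_family => /eqP.
by rewrite mxvec_eq0 => /eqP; exact: h.
Qed.

(* A maximal free family spans. *)
Lemma linear_family_basis : exists N (B : 'I_N -> 'M[R]_m) (al : 'I_N -> R)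
    (pi : 'I_N -> 'rV[R]_k),
  [/\ forall i, L (B i) (al i) (pi i),
      row_free (\matrix_i mxvec (B i)) &
      forall X a v, L X a v -> exists x, X = mxcomb B x].
Proof.
pose good N := `[< exists (B : 'I_N -> 'M[R]_m) (al : 'I_N -> R) (pi : 'I_N -> 'rV[R]_k),
  (forall i, L (B i) (al i) (pi i)) /\ row_free (\matrix_i mxvec (B i)) >].
have ex : exists N, good N.
  exists 0%N; apply/asboolP; exists (fun=> 0), (fun=> 0), (fun=> 0).
  by split=> [[]//|]; rewrite /row_free -leqn0 rank_leq_row.
have bd N : good N -> (N <= m * m)%N.
  by move=> /asboolP[B [al [pi [_ /eqP <-]]]]; exact: rank_leq_col.
have [N /asboolP[B [al [pi [hB fB]]]] maxN] := ex_maxnP ex bd.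
exists N, B, al, pi; split => // X a v LX; apply: contrapT => hX.
have := maxN N.+1; rewrite ltnn => h; suff: false by []; apply: h.
pose ext (T : Type) (f : 'I_N -> T) (t : T) (i : 'I_N.+1) :=
  if unlift ord0 i is Some j then f j else t.
apply/asboolP; exists (ext _ B X), (ext _ al a), (ext _ pi v); split.
  by move=> i; rewrite /ext; case: (unlift ord0 i).
apply/free_familyP => x; rewrite /mxcomb big_ord_recl /ext unlift_none.
pose y : 'rV[R]_N := \row_j x 0 (lift ord0 j).
have -> : \sum_(i < N) x 0 (lift ord0 i) *:
    (if unlift ord0 (lift ord0 i) is Some j then B j else X) = mxcomb B y.
  by apply: eq_bigr => i _; rewrite liftK mxE.
have [x0|x0] := eqVneq (x 0 ord0) 0.
  rewrite x0 scale0r add0r => /((free_familyP B).1 fB) y0.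
  apply/rowP => i; rewrite [RHS]mxE; case: (unliftP ord0 i) => [j|] -> //.
  by have := congr1 (fun z : 'rV_N => z 0 j) y0; rewrite !mxE.
move=> /eqP; rewrite addr_eq0 => /eqP e; case: hX; exists (- (x 0 ord0)^-1 *: y).
rewrite mxcombZ -[mxcomb B y]opprK -e scaleNr scalerN opprK scalerA mulVf ?scale1r //.
Qed.

Variables (N : nat) (B : 'I_N -> 'M[R]_m) (al : 'I_N -> R) (pi : 'I_N -> 'rV[R]_k).
Hypothesis LB : forall i, L (B i) (al i) (pi i).
Hypothesis freeB : row_free (\matrix_i mxvec (B i)).
Hypothesis spanB : forall X a v, L X a v -> exists x, X = mxcomb B x.

Let symB i : (B i)^T = B i.
Proof. by have [_ _ h] := linL; exact: h (LB i). Qed.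

(** The coordinates are linear in the entries because the family is free, and the entries of a psd
    matrix are at most its trace. This makes the slices compact. *)
Lemma family_coord_bound : exists2 C, 0 <= C &
  forall x, psd (mxcomb B x) -> forall i, `|x 0 i| <= C * \tr (mxcomb B x).
Proof.
have /row_freeP[G BG] := freeB.
exists (\sum_j \sum_i `|G i j|); first by rewrite sumr_ge0 // => j _; rewrite sumr_ge0.
move=> x hx i.
have e : x = mxvec (mxcomb B x) *m G by rewrite -mul_mxvec_family -mulmxA BG mulmx1.
have -> : x 0 i = \sum_l mxvec (mxcomb B x) 0 l * G l i by rewrite {1}e mxE.
rewrite (le_trans (ler_norm_sum _ _ _)) // mulr_suml (bigD1 i) //=.
rewrite -[leLHS]addr0 lerD //; last first.
  by apply: sumr_ge0 => j _; apply: mulr_ge0; [exact: sumr_ge0 | exact: psd_trace_ge0].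
rewrite mulr_suml ler_sum // => l _; rewrite normrM mulrC ler_wpM2l //.
by case/mxvec_indexP: l => a b; rewrite mxvecE psd_entry_le.
Qed.

Lemma family_functional_bound (f : 'I_N -> R) : exists2 C, 0 <= C &
  forall x, psd (mxcomb B x) -> `|\sum_i x 0 i * f i| <= C * \tr (mxcomb B x).
Proof.
have [C C0 hC] := family_coord_bound.
exists (\sum_i C * `|f i|); first by rewrite sumr_ge0 // => i _; rewrite mulr_ge0.
move=> x hx; rewrite (le_trans (ler_norm_sum _ _ _)) // mulr_suml ler_sum // => i _.
by rewrite normrM mulrAC ler_wpM2r // hC.
Qed.

Let A (x : 'rV[R]_N) := \sum_i x 0 i * al i.
Let V (x : 'rV[R]_N) := \sum_i x 0 i *: pi i.

Let VE x l : V x 0 l = \sum_i x 0 i * pi i 0 l.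
Proof. by rewrite summxE; apply: eq_bigr => i _; rewrite mxE. Qed.

Hypothesis m_gt0 : (0 < m)%N.
Hypothesis zero_matrix : forall a v, L 0 a v -> a = 0 /\ v = 0.
Hypothesis zero_functional : forall X, L X 0 0 -> psd X -> X = 0.
Variable x1 : 'rV[R]_N.
Hypothesis pd1 : pd (mxcomb B x1).

Lemma family_values X a v x : L X a v -> X = mxcomb B x -> a = A x /\ v = V x.
Proof.
move=> h e; have [_ LD _] := linL.
have := LD (-1) _ _ _ _ _ _ (linear_family_sum LB x) h.
rewrite scaleN1r mulN1r scaleN1r e addNr => /zero_matrix [/eqP + /eqP].
by rewrite ![- _ + _]addrC !subr_eq0 => /eqP -> /eqP ->.
Qed.

Lemma family_size_bound : exists2 C, 0 <= C &
  forall x, psd (mxcomb B x) -> size1 (A x) (V x) <= C * \tr (mxcomb B x).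
Proof.
have [C0 C00 hC0] := family_functional_bound al.
have /choice[C hC] l : exists C, 0 <= C /\ forall x, psd (mxcomb B x) ->
    `|\sum_i x 0 i * pi i 0 l| <= C * \tr (mxcomb B x).
  by have [C ? ?] := family_functional_bound (fun i => pi i 0 l); exists C.
exists (C0 + \sum_l C l); first by rewrite addr_ge0 // sumr_ge0 // => l _; case: (hC l).
move=> x hx; rewrite mulrDl lerD ?hC0 // mulr_suml ler_sum // => l _.
by rewrite VE; apply: (hC l).2.
Qed.

Let ip (a : R) (v : 'rV[R]_k) (b : R) (w : 'rV[R]_k) := a * b + \sum_l v 0 l * w 0 l.

(* The functional is the point of least norm in the image of the trace one slice. *)
Lemma strictly_positive_functional : exists b w eps, 0 < eps /\
  forall x, psd (mxcomb B x) -> eps * \tr (mxcomb B x) <= ip b w (A x) (V x).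
Proof.
pose D := [set x | psd (mxcomb B x)] `&` [set x | \tr (mxcomb B x) = 1].
have [C C0 hC] := family_coord_bound.
have clD : closed D.
  apply: closedI; first exact: closed_psd_mxcomb.
  apply: closed_eq_cst; apply: cont_sum => i; exact: cont_mxcomb.
have bD x : D x -> forall i, `|x 0 i| <= C.
  by move=> [/= hx t1] i; have := hC x hx i; rewrite t1 mulr1.
have t1 := pd_trace_gt0 m_gt0 pd1.
have scaleD x : psd (mxcomb B x) -> 0 < \tr (mxcomb B x) -> D ((\tr (mxcomb B x))^-1 *: x).
  move=> hx t0; split; rewrite /= mxcombZ; first by apply: psdZ; rewrite ?invr_ge0 ?(ltW t0).
  by rewrite linearZ /= mulVf ?gt_eqF.
have D0 : D !=set0 by exists ((\tr (mxcomb B x1))^-1 *: x1); apply: scaleD => //; apply: pd_psd.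
pose nq x := ip (A x) (V x) (A x) (V x).
have cA : continuous A.
  apply: cont_sum => i; apply: cont_mulr; last exact: cst_continuous.
  exact: coord_continuous.
have cV l : continuous (fun x => V x 0 l).
  under eq_fun do rewrite VE.
  apply: cont_sum => i; apply: cont_mulr; last exact: cst_continuous.
  exact: coord_continuous.
have cnq : continuous nq.
  apply: cont_addr; first exact: cont_mulr.
  by apply: cont_sum => l; exact: cont_mulr.
have [x0 [/= hx0 tx0] minx] := rV_attains_min D0 clD bD cnq.
pose eps := nq x0.
have AD x y : A (x + y) = A x + A y.
  by rewrite /A -big_split; apply: eq_bigr => i _; rewrite mxE mulrDl.
have AZ t x : A (t *: x) = t * A x.
  by rewrite /A mulr_sumr; apply: eq_bigr => i _; rewrite mxE mulrA.
have VD x y l : V (x + y) 0 l = V x 0 l + V y 0 l.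
  by rewrite !VE -big_split; apply: eq_bigr => i _; rewrite mxE mulrDl.
have VZ t x l : V (t *: x) 0 l = t * V x 0 l.
  by rewrite !VE mulr_sumr; apply: eq_bigr => i _; rewrite mxE mulrA.
(* Norm zero would give a psd member of trace 1 with the zero functional, which [zero_functional]
   excludes. *)
have eps0 : 0 < eps.
  have nq0 : 0 <= eps.
    rewrite /eps /nq /ip addr_ge0 -?expr2 ?sqr_ge0 // sumr_ge0 // => l _.
    by rewrite -expr2 sqr_ge0.
  rewrite lt_def nq0 andbT; apply/negP => /eqP e0.
  move: (e0); rewrite /eps /nq /ip => /eqP; rewrite paddr_eq0; last 2 first.
  - by rewrite -expr2 sqr_ge0.
  - by rewrite sumr_ge0 // => l _; rewrite -expr2 sqr_ge0.
  rewrite mulf_eq0 orbb => /andP[/eqP a0 /eqP].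
  move=> /psumr_eq0P v0.
  have {}v0 : V x0 = 0.
    apply/rowP => l; rewrite [RHS]mxE; apply/eqP; rewrite -[_ == 0]orbb -mulf_eq0 v0 //.
    by move=> j _; rewrite -expr2 sqr_ge0.
  have := linear_family_sum LB x0; rewrite -/(A x0) -/(V x0) a0 v0 => /zero_functional.
  by move=> /(_ hx0) e; move: tx0; rewrite /= e mxtrace0 => /eqP; rewrite eq_sym oner_eq0.
exists (A x0), (V x0), eps; split => // x hx.
have [t0|t0] := eqVneq (\tr (mxcomb B x)) 0.
  have X0 := psd_trace_eq0 hx t0.
  have -> : x = 0 by apply: (free_familyP B).1.
  have A0 : A 0 = 0 by rewrite /A big1 // => i _; rewrite mxE mul0r.
  rewrite /mxcomb big1 ?mxtrace0 => [|i _]; last by rewrite mxE scale0r.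
  rewrite mulr0 /ip A0 mulr0 big1 ?addr0 // => l _.
  suff -> : V 0 0 l = 0 by rewrite mulr0.
  by rewrite VE big1 // => i _; rewrite mxE mul0r.
have {}t0 : 0 < \tr (mxcomb B x) by rewrite lt_def t0 psd_trace_ge0.
set T := \tr (mxcomb B x) in t0 *.
have [y ey [/= hy ty]] : exists2 y, x = T *: y & D y.
  exists (T^-1 *: x); last exact: scaleD.
  by rewrite scalerA divff ?scale1r // gt_eqF.
have nqE t z : nq (x0 + t *: z) =
    nq x0 + 2 * t * ip (A x0) (V x0) (A z) (V z) + t ^+ 2 * nq z.
  rewrite /nq /ip AD AZ.
  have -> : \sum_l V (x0 + t *: z) 0 l * V (x0 + t *: z) 0 l =
      \sum_l V x0 0 l * V x0 0 l + 2 * t * (\sum_l V x0 0 l * V z 0 l)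
      + t ^+ 2 * \sum_l V z 0 l * V z 0 l.
    rewrite !mulr_sumr -!big_split; apply: eq_bigr => l _ /=.
    by rewrite VD VZ; ring.
  ring.
have key t : 0 <= t <= 1 ->
    0 <= 2 * t * ip (A x0) (V x0) (A (y - x0)) (V (y - x0)) + t ^+ 2 * nq (y - x0).
  move=> /andP[t0' t1'].
  have Dt : D (x0 + t *: (y - x0)).
    have e : x0 + t *: (y - x0) = (1 - t) *: x0 + t *: y.
      by rewrite scalerBr scalerBl scale1r addrCA addrC.
    split; rewrite /= e mxcombD !mxcombZ.
      by apply: psdD; [apply: psdZ; rewrite ?subr_ge0 | exact: psdZ].
    by rewrite linearD !linearZ /= tx0 ty !mulr1 subrK.
  by have := minx _ Dt; rewrite nqE -addrA lerDl.
(* First-order optimality of [x0] along the segment to [y]: the functional takes at [y] at least its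
   value [eps] at [x0]. *)
have slope : 0 <= ip (A x0) (V x0) (A (y - x0)) (V (y - x0)).
  set b := ip _ _ _ _ in key *; set c := nq _ in key.
  rewrite leNgt; apply/negP => b0.
  (* At this [t] the linear term [2 t b] outweighs [t ^+ 2 * c]. *)
  pose t := Num.min 1 (- b / (`|c| + 1)).
  have c1 : 0 < `|c| + 1 by rewrite ltr_wpDl.
  have tt : 0 < t by rewrite lt_min ltr01 divr_gt0 // oppr_gt0.
  have t1' : t <= 1 by rewrite ge_min lexx.
  have := key t; rewrite (ltW tt) t1' => /(_ isT).
  have -> : 2 * t * b + t ^+ 2 * c = t * (2 * b + t * c) by ring.
  rewrite pmulr_rge0 // leNgt => /negP; apply.
  have tc : t * c <= - b.
    apply: (@le_trans _ _ (t * (`|c| + 1))).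
      by rewrite ler_pM2l // (le_trans (ler_norm c)) // lerDl.
    by rewrite -ler_pdivlMr // ge_min lexx orbT.
  by move: (t * c) tc b0 => u; lra.
have ipy : ip (A x0) (V x0) (A y) (V y) =
    eps + ip (A x0) (V x0) (A (y - x0)) (V (y - x0)).
  rewrite /eps /nq -[in LHS](subrK x0 y) addrC AD /ip.
  have -> : \sum_l V x0 0 l * V (x0 + (y - x0)) 0 l =
      \sum_l V x0 0 l * V x0 0 l + \sum_l V x0 0 l * V (y - x0) 0 l.
    by rewrite -big_split; apply: eq_bigr => l _; rewrite VD mulrDr.
  by rewrite mulrDr addrACA.
have -> : ip (A x0) (V x0) (A x) (V x) = T * ip (A x0) (V x0) (A y) (V y).
  rewrite [in LHS]ey /ip AZ mulrDr mulr_sumr; congr (_ + _); first by rewrite mulrCA.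
  by apply: eq_bigr => l _; rewrite VZ mulrCA.
by rewrite mulrC ler_pM2l // ipy lerDl.
Qed.

Lemma family_size_leq : (N <= 'C(m.+1, 2))%N.
Proof.
rewrite -card_upper.
pose coB : 'M[R]_(N, #|upper m|) := \matrix_(i, l) coord_sym (B i) l.
suff /eqP <- : row_free coB by exact: rank_leq_col.
rewrite -kermx_eq0; apply/rowV0P => x /sub_kermxP xB.
apply: (free_familyP B).1 => //; apply: sym_upper_inj; first exact: mxcomb_sym.
  by rewrite trmx0.
move=> l; rewrite /mxcomb coord_sym_sum [RHS]mxE.
have /matrixP/(_ 0 l) := xB; rewrite !mxE => h; rewrite -[RHS]h.
by apply: eq_bigr => i _; rewrite coord_symZ mxE.
Qed.

Lemma family_size_gt0 : (0 < N)%N.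
Proof.
rewrite lt0n; apply/negP => /eqP N0.
have : mxcomb B x1 = 0.
  by apply: big1 => i _; case: (cast_ord N0 i).
by move=> e; have := pd_trace_gt0 m_gt0 pd1; rewrite e mxtrace0 ltxx.
Qed.

(** In homogeneous coordinates this is the path [(1, c) + t (b, w)], rescaled to first coordinate 1.
    The rescaling is forced because a strictly positive functional may have a constant part [b]. *)
Lemma aff_path t b w c a v : 1 + t * b != 0 ->
  aff ((1 + t * b)^-1 *: (c + t *: w)) a v =
  (1 + t * b)^-1 * (aff c a v + t * ip b w a v).
Proof.
move=> t0; rewrite /aff /ip.
have -> : \sum_l ((1 + t * b)^-1 *: (c + t *: w)) 0 l * v 0 l =
   (1 + t * b)^-1 * (\sum_l c 0 l * v 0 l + t * \sum_l w 0 l * v 0 l).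
  rewrite mulrDr !mulr_sumr -big_split; apply: eq_bigr => l _.
  by rewrite !mxE /=; ring.
by field.
Qed.

Lemma aff_family c x : aff c (A x) (V x) = \sum_i x 0 i * (al i + \sum_l pi i 0 l * c 0 l).
Proof.
rewrite /aff /A; under [X in _ + X]eq_bigr do rewrite VE mulr_sumr.
rewrite exchange_big -big_split; apply: eq_bigr => i _ /=.
by rewrite mulrDr mulr_sumr; congr (_ + _); apply: eq_bigr => l _; ring.
Qed.

(** Near a tight [c] lies [c'], shifted along a strictly positive functional. Even after the
    perturbation [r eta] its functional is strictly positive and takes a small value at a nearly
    tight member, so there is a central point with [s] between a fixed positive [sig] and [eps]. The
    relation is then used along the line [Z + q Y]. *)
Lemma main_case : eliminable L.
Proof.
have Ngt := family_size_gt0; have Nle := family_size_leq.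
have eN : N = N.-1.+1 by rewrite prednK.
have M0 : (0 < 'C(m.+1, 2))%N by apply: leq_trans Nle.
have eC : 'C(m.+1, 2).-1.+1 = 'C(m.+1, 2) by rewrite prednK.
have eM : #|upper m| = 'C(m.+1, 2).-1.+1 by rewrite eC card_upper.
have [|E ED hE] := monomial_count eC (n := N.-1).
  by rewrite -ltnS eC -eN.
have [P [P0 Psz PR]] := polynomial_relation_dim eN eM
  (fun i l => \tr (B i *m unit_sym R l))
  (fun j i l => coord_sym (jordan (B i) (unit_sym R l)) j)
  (fun i => \tr (B i)) ED hE.
have [w [eta [p [p0 psz hp]]]] :=
  elimination (coord_sym (2%:M : 'M[R]_m)) al (fun i l => pi i 0 l) P0 Psz.
exists p; split => // c [c_ge0 c_tight]; apply: hp => eps /andP[eps0 eps1].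
have [b [u [e0 [e00 hpos]]]] := strictly_positive_functional.
have [C1 C10 hC1] := family_size_bound.
have [C3 C30 hC3] := family_functional_bound eta.
have [C C0 hC] := family_coord_bound.
have [C2 C20 hC2] : exists2 C2, 0 <= C2 &
    forall x, psd (mxcomb B x) -> ip b u (A x) (V x) <= C2 * \tr (mxcomb B x).
  have bu0 : 0 <= `|b| + \sum_l `|u 0 l| by rewrite addr_ge0 // sumr_ge0.
  exists ((`|b| + \sum_l `|u 0 l|) * C1); first by rewrite mulr_ge0.
  move=> x hx; rewrite (@le_trans _ _ ((`|b| + \sum_l `|u 0 l|) * size1 (A x) (V x))) //.
    rewrite /size1 mulrDr lerD //.
      by rewrite (le_trans (ler_norm _)) // normrM ler_wpM2r // lerDl sumr_ge0.
    rewrite mulr_sumr ler_sum // => l _.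
    rewrite (le_trans (ler_norm _)) // normrM ler_wpM2r // (bigD1 l) //= addrCA lerDl.
    by rewrite addr_ge0 // sumr_ge0.
  by rewrite -mulrA ler_wpM2l // hC1.
have [Kc Kc0 Kl] : exists2 Kc, 0 <= Kc &
    forall l, `|u 0 l| + `|b| * `|c 0 l| <= Kc.
  exists (\sum_l (`|u 0 l| + `|b| * `|c 0 l|)).
    by apply: sumr_ge0 => l _; rewrite addr_ge0 // mulr_ge0.
  by move=> l; rewrite (bigD1 l) //= lerDl sumr_ge0.
have [b1 b10 hb1] : exists2 b1, 0 <= b1 & `|b| = b1 by exists `|b|.
(* All upper bounds imposed on [t] are summed, so that [t = eps / big] meets each of them. *)
pose big := 1 + (2 * b1 + (2 * Kc + (2 * C1 + (2 * C2 + e0)))).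
have big0 : 0 < big.
  by rewrite ltr_pwDl // !addr_ge0 ?mulr_ge0 // ltW.
pose t := eps / big.
have t0 : 0 < t by rewrite divr_gt0.
have tbig : t * big = eps by rewrite divfK // gt_eqF.
have tle y : y <= big -> t * y <= eps by move=> ybig; rewrite -tbig ler_pM2l.
have tb : `|t * b| <= 2^-1.
  have : t * (2 * b1) <= eps by apply: tle; rewrite /big; lra.
  by rewrite normrM gtr0_norm // hb1; lra.
have tK : t * (2 * Kc) <= eps by apply: tle; rewrite /big; lra.
have tC : t * (2 * C1 + 2 * C2 + e0) <= eps by apply: tle; rewrite /big; lra.
pose g := (1 + t * b)^-1.
have [g1 g2] : 2^-1 <= 1 + t * b /\ 1 + t * b <= 3 / 2.
  exact: near_one_bounds.
have g0 : 0 < 1 + t * b by lra.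
have gle : g <= 2 by rewrite /g invf_ple ?posrE.
have gge : 2 / 3 <= g by rewrite /g -[2/3]invrK lef_pV2 ?posrE ?invr_gt0 ?divr_gt0 // invf_div.
have gg0 : 0 < g by rewrite invr_gt0.
pose c' := (1 + t * b)^-1 *: (c + t *: u).
(* The shift contributes at least [2/3 * t * e0] since [g >= 2/3]; one third of [t * e0] is reserved
   for the perturbation by [r], and one third remains. *)
pose e1 := t * e0 / 3.
have e10 : 0 < e1 by rewrite divr_gt0 // mulr_gt0.
have mR : 0 < m%:R :> R by rewrite ltr0n.
(* The lower bound [e1 / m] for [s] depends on [t] but not on [rho], as the order of quantifiers in
   [elimination] demands. *)
exists (fun l => c' 0 l), (e1 / m%:R); split; last 1 first.
- move=> rho rho0; pose r := Num.min rho (e1 / (C3 + 1)).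
  have C31 : 0 < C3 + 1 by rewrite ltr_wpDl.
  have r0 : 0 < r by rewrite lt_min rho0 divr_gt0.
  have rC3 : r * C3 <= e1.
    rewrite (@le_trans _ _ (r * (C3 + 1))) // ?ler_pM2l ?lerDl //.
    by rewrite -ler_pdivlMr // ge_min lexx orbT.
  pose zeta : 'rV[R]_N := \row_i (al i + \sum_l pi i 0 l * c' 0 l + r * eta i).
  have pairE x : pairing zeta x =
      g * (aff c (A x) (V x) + t * ip b u (A x) (V x)) + r * \sum_i x 0 i * eta i.
    rewrite -aff_path ?gt_eqF // aff_family mulr_sumr -big_split.
    by apply: eq_bigr => i _; rewrite mxE /=; ring.
  have low x : psd (mxcomb B x) -> e1 * \tr (mxcomb B x) <= pairing zeta x.
    move=> hx; rewrite pairE; set T := \tr _.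
    have T0 : 0 <= T by exact: psd_trace_ge0.
    have h1 := c_ge0 _ _ _ (linear_family_sum LB x) hx.
    have h2 := hpos x hx; have := hC3 x hx; rewrite ler_norml => /andP[h3 _].
    have k1 : 2 / 3 * (t * (e0 * T)) <= g * (aff c (A x) (V x) + t * ip b u (A x) (V x)).
      apply: ler_pM => //.
        by apply: mulr_ge0; [exact: ltW|apply: mulr_ge0 => //; exact: ltW].
      by rewrite -[leLHS]add0r lerD // ler_pM2l.
    have k2 : - (e1 * T) <= r * \sum_i x 0 i * eta i.
      rewrite (@le_trans _ _ (r * - (C3 * T))) // ?ler_pM2l //.
      by rewrite mulrN lerN2 mulrA ler_wpM2r.
    rewrite (le_trans _ (lerD k1 k2)) // /e1.
    by have -> : 2 / 3 * (t * (e0 * T)) - t * e0 / 3 * T = t * e0 / 3 * T by field.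
  (* Tightness is used at the scale [t]: the value at this member is at most of order [t] times its
     trace, like the shift itself. *)
  have [X [a [v [LX hX lt]]]] := c_tight t t0.
  have [x0 Xx0] := spanB LX; have [av vv] := family_values LX Xx0.
  rewrite Xx0 in hX; rewrite av vv in lt.
  have s0 : 0 < size1 (A x0) (V x0).
    rewrite lt_def size1_ge0 andbT; apply/negP => /eqP e.
    by move: lt; rewrite e mulr0 ltNge (c_ge0 _ _ _ (linear_family_sum LB x0) hX).
  have sC := hC1 x0 hX.
  set T := \tr (mxcomb B x0) in sC.
  have T0 : 0 < T.
    rewrite lt_def psd_trace_ge0 // andbT; apply/negP => /eqP e.
    by have := lt_le_trans s0 sC; rewrite e mulr0 ltxx.
  have up : pairing zeta x0 <= eps * T.
    rewrite pairE; have := hC3 x0 hX; rewrite ler_norml -/T => /andP[_ h3].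
    have h2 := hC2 x0 hX; rewrite -/T in h2.
    have h1 : aff c (A x0) (V x0) <= t * (C1 * T).
      by rewrite (le_trans (ltW lt)) // ler_pM2l.
    have k1 : g * (aff c (A x0) (V x0) + t * ip b u (A x0) (V x0)) <=
        2 * (t * (C1 * T) + t * (C2 * T)).
      rewrite (@le_trans _ _ (g * (t * (C1 * T) + t * (C2 * T)))) //.
        by rewrite ler_pM2l // lerD // ler_pM2l.
      have tT : 0 <= t * (C1 * T) + t * (C2 * T).
        by rewrite -mulrDr -mulrDl; apply: mulr_ge0; [exact: ltW|apply: mulr_ge0; [exact: addr_ge0|exact: ltW]].
      exact: ler_wpM2r.
    have k2 : r * (\sum_i x0 0 i * eta i) <= e1 * T.
      rewrite (@le_trans _ _ (r * (C3 * T))) // ?ler_pM2l //.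
      by rewrite mulrA ler_wpM2r // ltW.
    rewrite (le_trans (lerD k1 k2)) // (@le_trans _ _ (t * (2 * C1 + 2 * C2 + e0) * T)) //.
      rewrite -subr_ge0 /e1.
      have -> : t * (2 * C1 + 2 * C2 + e0) * T - (2 * (t * (C1 * T) + t * (C2 * T)) +
         t * e0 / 3 * T) = 2 / 3 * (t * e0 * T) by field.
      have teT : 0 <= t * e0 * T by apply: mulr_ge0; [apply: mulr_ge0; exact: ltW|exact: ltW].
      by apply: mulr_ge0 => //; exact: divr_ge0.
    by rewrite ler_wpM2r // ltW.
  have [x [Z [s [[pdX tr1] sZ [XZ ZX] trZ /andP[sl su]]]]] :=
    central_point symB m_gt0 pd1 hC e10 low hX T0 up.
  (* Solving the Lyapunov equation for the generic direction [w] makes the symmetrized product at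
     [Z + q Y] equal to [2 s I + q w]. *)
  have [Y [sY jY]] := jordan_surj pdX (of_coord_sym w).
  pose h i : {poly R} := (\tr (B i *m Z))%:P + (\tr (B i *m Y))%:P * 'X.
  exists r, s, h; split.
  + by rewrite r0 ge_min lexx.
  + by rewrite sl su.
  + move=> i; rewrite hornerD hornerM !hornerC hornerX mulr0 addr0 trZ.
    by rewrite mxE.
  move=> q; pose z := coord_sym (Z + q *: Y).
  have sq : (Z + q *: Y)^T = Z + q *: Y by rewrite linearD linearZ /= sZ sY.
  have := PR (fun i => x 0 i) z.
  have -> : \sum_i \tr (B i) * x 0 i = 1.
    rewrite -tr1 /mxcomb linear_sum; apply: eq_bigr => i _.
    by rewrite linearZ /= mulrC.
  move=> /(_ erefl).
  have -> : (fun i => \sum_l \tr (B i *m unit_sym R l) * z l) = (fun i => (h i).[q]).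
    apply/funext => i; rewrite hornerD hornerM !hornerC hornerX.
    transitivity (\tr (B i *m (Z + q *: Y))); last first.
      by rewrite mulmxDr linearD /= -scalemxAr linearZ /= mulrC.
    rewrite -(coord_symK sq) /of_coord mulmx_sumr linear_sum; apply: eq_bigr => l _.
    by rewrite -scalemxAr linearZ /= mulrC.
  suff -> : (fun j => mpolyC N (\sum_i \sum_l
      coord_sym (jordan (B i) (unit_sym R l)) j * x 0 i * z l)) =
      (fun j => mpolyC N (s * coord_sym (2%:M : 'M[R]_m) j + q * w j)) by [].
  apply/funext => j; congr (mpolyC N _).
  transitivity (coord_sym (jordan (mxcomb B x) (Z + q *: Y)) j); last first.
    have -> : jordan (mxcomb B x) (Z + q *: Y) = s *: 2%:M + q *: of_coord w.
      rewrite -jY /jordan mulmxDr mulmxDl addrACA XZ ZX -scalemxAr -scalemxAl -scalerDr.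
      by rewrite scale_scalar_mx mulr_natr mulr2n -raddfD.
    by rewrite coord_symD !coord_symZ of_coordK.
  rewrite -(coord_symK sq) -/z /jordan /mxcomb mulmx_suml mulmx_sumr -big_split coord_sym_sum.
  apply: eq_bigr => i _.
  rewrite /= -scalemxAl -scalemxAr -scalerDr coord_symZ /of_coord mulmx_sumr mulmx_suml.
  rewrite -big_split coord_sym_sum mulr_sumr; apply: eq_bigr => l _ /=.
  by rewrite -scalemxAr -scalemxAl -scalerDr coord_symZ [RHS]mulrA [RHS]mulrC [RHS]mulrA.
- move=> l; rewrite /c' !mxE.
  have -> : (1 + t * b)^-1 * (c 0 l + t * u 0 l) - c 0 l = g * (t * (u 0 l - b * c 0 l)).
    by rewrite /g; field; rewrite gt_eqF.
  rewrite normrM gtr0_norm // (@le_trans _ _ (2 * (t * Kc))) //; last first.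
    by rewrite mulrCA.
  apply: ler_pM => //; first exact: ltW.
  rewrite normrM (gtr0_norm t0) ler_pM2l // (le_trans _ (Kl l)) //.
  by rewrite (le_trans (ler_normB _ _)) // normrM.
- by rewrite divr_gt0.
Qed.

End Main.
End ConeData.

(** * Facial reduction *)

Section Induction.
Variables (R : realType) (k : nat).

Definition aff_poly (a : R) (v : 'rV[R]_k) : mpoly k R :=
  mpolyC k a + \sum_l v 0 l *: mpolyX R (mnm1 l).

Lemma meval_aff_poly (c : 'rV[R]_k) a v : meval (fun l => c 0 l) (aff_poly a v) = aff c a v.
Proof.
rewrite /aff_poly mevalD mevalC; congr (_ + _).
rewrite (meval_sum (fun l => c 0 l)); apply: eq_bigr => l _; rewrite mevalZ mulrC.
by congr (_ * _); exact: mevalXU.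
Qed.

Lemma msize_aff_poly a v : (msize (aff_poly a v) <= 2)%N.
Proof.
apply: leq_trans (msizeD_le _ _) _; rewrite geq_max msizeC; apply/andP; split.
  by case: (a != 0).
apply: leq_trans (msize_sum _ _ _) _; apply/bigmax_leqP => l _.
by apply: leq_trans (msizeZ_le _ _) _; rewrite msizeX mdeg1.
Qed.

Lemma aff_poly_neq0 a v : ~ (a = 0 /\ v = 0) -> aff_poly a v != 0.
Proof.
move=> av; apply/negP => /eqP p0; apply: av.
have h c : aff c a v = 0 by rewrite -meval_aff_poly p0 meval0.
have a0 : a = 0.
  by rewrite -[RHS](h 0) /aff big1 ?addr0 // => l _; rewrite mxE mul0r.
split => //; apply/rowP => l; rewrite mxE -[RHS](h (delta_mx 0 l)) /aff a0 add0r.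
rewrite (bigD1 l) //= mxE !eqxx mul1r big1 ?addr0 // => j /negPf jl.
by rewrite mxE jl andbF mul0r.
Qed.

Lemma elimdeg_gt0 m : (0 < elimdeg m)%N.
Proof. by rewrite expn_gt0. Qed.

Lemma leq_elimdeg m m' : (m' <= m)%N -> (elimdeg m' <= elimdeg m)%N.
Proof.
move=> h; rewrite leq_exp2l // -!subn1 leq_sub2r //.
by case: m' h => [|m'] h; rewrite ?exp0n // leq_exp2r.
Qed.

Lemma eliminable_transfer m m' (L : 'M[R]_m -> R -> 'rV[R]_k -> Prop)
    (L' : 'M[R]_m' -> R -> 'rV[R]_k -> Prop) : (m' <= m)%N ->
  (forall c, tight L c -> tight L' c) -> eliminable L' -> eliminable L.
Proof.
move=> mm h [p [p0 psz hp]]; exists p; split => //.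
  by apply: leq_trans psz _; rewrite ltnS leq_elimdeg.
by move=> c /h /hp.
Qed.

(** The row space of a symmetric matrix is the orthogonal complement of its kernel, so inclusions
    reverse. *)
Lemma sym_submx m (A B : 'M[R]_m) : A^T = A -> B^T = B ->
  (forall u : 'rV_m, u *m A = 0 -> u *m B = 0) -> (B <= A)%MS.
Proof.
move=> sA sB h; rewrite submxE; apply/eqP.
rewrite -[LHS]trmxK trmx_mul sB -[RHS]trmx0; congr (_^T).
apply/row_matrixP => i; rewrite row0 row_mul; apply: h.
by rewrite -row_mul -{2}sA -trmx_mul mulmx_coker trmx0 row0.
Qed.

(** A kernel vector of the sum annihilates both nonnegative forms. *)
Lemma psd_submxDl m (A B : 'M[R]_m) : psd A -> psd B -> (A <= (A + B)%R)%MS.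
Proof.
move=> hA hB; have [sA qA] := (psdP A).1 hA; have [sB qB] := (psdP B).1 hB.
apply: sym_submx => // [|u uAB]; first by rewrite linearD /= sA sB.
 apply: psd_ker => //; apply/eqP.
have : qf A u + qf B u == 0 by rewrite -qfDm /qf uAB mul0mx mxE.
by rewrite paddr_eq0 // => /andP[].
Qed.

(** Induction on the matrix size. A family without a positive definite member is compressed to the
    range of a psd member of maximal rank; a family with a nonzero psd member [Y] carrying the zero
    functional is compressed to the kernel of [Y]. When neither reduction applies, central points
    are available. *)
Lemma linear_family_eliminable m (L : 'M[R]_m -> R -> 'rV[R]_k -> Prop) :
  linear_family L -> eliminable L.
Proof.
have [n] := ubnP m; elim: n m L => // n IH m L mn linL.
have [L0 LD Lsym] := linL.
have [[a [v [L0av av]]]|zm] :=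
    pselect (exists a v, L 0 a v /\ ~ (a = 0 /\ v = 0)).
  (* Both signs of this functional sit over the zero matrix, so every tight [c] satisfies the affine
     equation. *)
  exists (aff_poly a v); split; first exact: aff_poly_neq0.
    by apply: leq_trans (msize_aff_poly _ _) _; rewrite ltnS elimdeg_gt0.
  move=> c [cge _]; rewrite meval_aff_poly.
  have psd0 : psd (0 : 'M[R]_m) by rewrite psdP trmx0; split => // u; rewrite qf0.
  have h1 := cge _ _ _ L0av psd0.
  have := LD (-1) _ _ _ _ _ _ L0av L0; rewrite scaler0 !addr0 => /cge /(_ psd0).
  by rewrite affZ mulN1r oppr_ge0 => h2; apply/eqP; rewrite eq_le h1 h2.
have zero_matrix a v : L 0 a v -> a = 0 /\ v = 0.
  by move=> h; apply: contrapT => av; apply: zm; exists a, v.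
case: (posnP m) => [m0|m0].
  (* No [c] is tight: the only member is zero, and [0 < eps * 0] fails. Hence the constant 1 will
     do. *)
  exists 1; split; rewrite ?oner_neq0 ?msize1 // => c [_ /(_ 1 ltr01)] [X [a [v [LX _]]]].
  have X0 : X = 0 by apply/matrixP => i; case: (cast_ord m0 i).
  move: LX; rewrite X0 => /zero_matrix[-> ->]; rewrite aff0 mul1r /size1 normr0 add0r.
  by rewrite big1 ?ltxx // => l _; rewrite mxE normr0.
pose rk r := `[< exists X a v, [/\ L X a v, psd X & \rank X = r] >].
have exrk : exists r, rk r.
  exists 0%N; apply/asboolP; exists 0, 0, 0; split; rewrite ?mxrank0 //.
  by rewrite psdP trmx0; split => // u; rewrite qf0.
have bdrk r : rk r -> (r <= m)%N by move=> /asboolP[X [a [v [_ _ <-]]]]; exact: rank_leq_row.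
have [r /asboolP[X1 [a1 [v1 [LX1 hX1 rX1]]]] rmax] := ex_maxnP exrk bdrk.
have [rm|] := ltnP r m.
  (* Otherwise [X + X1] would exceed the maximal rank. *)
  have dom X a v : L X a v -> psd X -> (X <= X1)%MS.
    move=> LX hX; have hS := psdD hX hX1.
    have LS : L (X + X1) (a + a1) (v + v1).
      by have := LD 1 _ _ _ _ _ _ LX LX1; rewrite !scale1r mul1r.
    have rS : (\rank (X + X1)%R <= \rank X1)%N.
      by rewrite rX1; apply: rmax; apply/asboolP; exists (X + X1), (a + a1), (v + v1).
    have X1S : (X1 <= (X + X1)%R)%MS by rewrite addrC; exact: psd_submxDl.
    have SX1 : ((X + X1)%R <= X1)%MS by rewrite -(mxrank_leqif_sup X1S) eqn_leq mxrankS.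
    by apply: submx_trans SX1; exact: psd_submxDl.
  have [U [W UW]] : exists (U : 'M[R]_(\rank X1, m)) (W : 'M[R]_(m, \rank X1)),
      forall X : 'M[R]_m, (X <= X1)%MS -> X *m W *m U = X.
    by exists (row_base X1), (pinvmx (row_base X1)) => X ?; rewrite mulmxKpV ?eq_row_base.
  pose L' (X' : 'M[R]_(\rank X1)) a v := X'^T = X' /\ L (U^T *m X' *m U) a v.
  apply: (@eliminable_transfer _ _ _ L'); first by rewrite rX1 ltnW.
    move=> c [cge ctight]; split.
      move=> X' a v [_ LX'] hX'; apply: cge LX' _.
      by rewrite -{2}(trmxK U); apply: psd_congr.
    move=> eps /ctight [X [a [v [LX hX lt]]]].
    have XU : X *m W *m U = X by apply: UW; apply: dom LX hX.
    have UX : U^T *m W^T *m X = X.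
      by have := congr1 trmx XU; rewrite !trmx_mul (Lsym _ _ _ LX) mulmxA.
    have hX' : psd (W^T *m X *m W) by rewrite -{2}(trmxK W); apply: psd_congr.
    exists (W^T *m X *m W), a, v; split => //; split; first by case: ((psdP _).1 hX').
    by rewrite !mulmxA UX XU.
  apply: IH; first by rewrite rX1 (leq_trans rm) // -ltnS.
  split; first by split; rewrite ?trmx0 // mulmx0 mul0mx.
    move=> t X a v Y b w [sX LX] [sY LY]; split; first by rewrite linearD linearZ /= sX sY.
    rewrite mulmxDr mulmxDl -scalemxAr -scalemxAl; exact: LD.
  by move=> X a v [].
move=> mr; have uX1 : X1 \in unitmx by rewrite -row_full_unit /row_full rX1 eqn_leq mr -rX1 rank_leq_col.
have pd1 : pd X1.
  by apply: psd_pd => // u /(congr1 (mulmx^~ (invmx X1))); rewrite mulmxK // mul0mx.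
have [[Y [LY hY Y0]]|zf] := pselect (exists Y, [/\ L Y 0 0, psd Y & Y <> 0]).
  have [K hK] : exists K : 'M[R]_(\rank (kermx Y), m),
      forall u : 'rV_m, u *m Y = 0 -> exists w, u = w *m K.
    exists (row_base (kermx Y)) => u /sub_kermxP.
    by rewrite -(eq_row_base (kermx Y)) => /submxP.
  pose L' (X' : 'M[R]_(\rank (kermx Y))) a v := exists X, L X a v /\ X' = K *m X *m K^T.
  have rK : (\rank (kermx Y) < m)%N.
    by rewrite mxrank_ker ltn_subrL m0 andbT lt0n mxrank_eq0; apply/eqP.
  apply: (@eliminable_transfer _ _ _ L'); first exact: ltnW.
    move=> c [cge ctight]; split; last first.
      move=> eps /ctight [X [a [v [LX hX lt]]]]; exists (K *m X *m K^T), a, v.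
      by split => //; [exists X | exact: psd_congr].
    move=> X' a v [X [LX ->]] hX'.
    (* Adding [e X1] makes the compression positive definite, so Finsler's lemma gives a psd member
       after adding a multiple of [Y], which costs nothing because its functional is zero. *)
    have he e : 0 < e -> 0 <= aff c a v + e * aff c a1 v1.
      move=> e0; have LE : L (e *: X1 + X) (e * a1 + a) (e *: v1 + v) by exact: LD.
      have [|l l0 hl] := @finsler _ _ (e *: X1 + X) Y (Lsym _ _ _ LE) hY.
        move=> u u0 /hK[w uw].
        rewrite qfDm qfZm ltr_pwDl //; first by rewrite mulr_gt0 //; exact: pd1.2.
        by rewrite uw -qf_congr; case: ((psdP _).1 hX').
      have := LD l _ _ _ _ _ _ LY LE; rewrite mulr0 scaler0 !add0r addrC => /cge /(_ hl).
      by rewrite affD affZ addrC.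
    rewrite leNgt; apply/negP => n0; pose y := aff c a1 v1.
    have y1 : 0 < `|y| + 1 by rewrite ltr_wpDl.
    (* For this [e] the sum is still less than or equal to [aff c a v / 2], a negative number. *)
    have := he (- aff c a v / (2 * (`|y| + 1))); rewrite divr_gt0 ?oppr_gt0 ?mulr_gt0 //.
    move=> /(_ isT); apply/negP; rewrite -ltNge -/y.
    rewrite (@le_lt_trans _ _ (aff c a v + - aff c a v / (2 * (`|y| + 1)) * (`|y| + 1))) //.
      rewrite lerD2l ler_pM2l; last by rewrite divr_gt0 ?oppr_gt0 ?mulr_gt0.
      by rewrite (le_trans (ler_norm _)) // lerDl.
    have -> : aff c a v + - aff c a v / (2 * (`|y| + 1)) * (`|y| + 1) = aff c a v / 2.
      by field; rewrite gt_eqF.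
    by rewrite pmulr_llt0 // invr_gt0.
  apply: IH; first by rewrite (leq_trans rK) // -ltnS.
  split; first by exists 0; rewrite mulmx0 mul0mx.
    move=> t X a v Z b w [X' [LX ->]] [Z' [LZ ->]]; exists (t *: X' + Z'); split; first exact: LD.
    by rewrite mulmxDr mulmxDl -scalemxAr -scalemxAl.
  by move=> X a v [X' [LX ->]]; rewrite !trmx_mul trmxK (Lsym _ _ _ LX) mulmxA.
have [N [B [al [pi [LB freeB spanB]]]]] := linear_family_basis L.
have [x1 ex1] := spanB _ _ _ LX1.
apply: (main_case linL LB freeB spanB m0 zero_matrix _ (x1 := x1)); last by rewrite -ex1.
by move=> X LX hX; apply: contrapT => X0; apply: zf; exists X.
Qed.

End Induction.

(** * Lifts and polars *)

Section Lift.
Variables (R : realType) (k : nat).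

Lemma polar_affE (C : set 'rV[R]_k) c : polar C c <-> forall x, C x -> 0 <= aff c 1 (- x).
Proof.
have e x : aff c 1 (- x) = 1 - (c *m x^T) 0 0.
  rewrite /aff mxE -sumrN; congr (_ + _); apply: eq_bigr => l _.
  by rewrite !mxE mulrN.
by split=> h x Cx; have := h x Cx; rewrite e subr_ge0.
Qed.

Lemma closed_polar (C : set 'rV[R]_k) : closed (polar C).
Proof.
have -> : polar C = \bigcap_(x in C) [set c | 0 <= aff c 1 (- x)].
  by apply/seteqP; split => c /polar_affE.
apply: closed_bigI => x _; apply: closed_ge0; apply: cont_addr; first exact: cst_continuous.
apply: cont_sum => l; apply: cont_mulr; last exact: cst_continuous.
exact: coord_continuous.
Qed.

(** [size1] is dual to the sup norm of the topology: a slack of [eps * size1] at every point leaves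
    room for the ball of radius [eps] around [c]. *)
Lemma boundary_polar_approx (C : set 'rV[R]_k) c : boundary (polar C) c ->
  polar C c /\ forall eps, 0 < eps -> exists2 x, C x & aff c 1 (- x) < eps * size1 1 (- x).
Proof.
move=> [clc nint]; split; first exact: closed_polar.
move=> eps eps0; apply: contrapT => h; apply: nint.
apply/nbhs_ballP; exists eps => //= c' [_ cc'].
apply/polar_affE => x Cx; rewrite leNgt; apply/negP => neg; apply: h; exists x => //.
have -> : aff c 1 (- x) = aff c' 1 (- x) + \sum_l (c 0 l - c' 0 l) * (- x) 0 l.
  rewrite /aff -addrA; congr (_ + _); rewrite -big_split; apply: eq_bigr => l _ /=.
  by ring.
apply: (@lt_le_trans _ _ (0 + eps * \sum_l `|(- x) 0 l|)).
  apply: ltr_leD => //; rewrite mulr_sumr ler_sum // => l _.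
  rewrite (le_trans (ler_norm _)) // normrM ler_wpM2r // ltW //; exact: cc'.
by rewrite add0r ler_pM2l // /size1 lerDr.
Qed.

Variables (C : set 'rV[R]_k) (m n : nat) (A0 : 'M[R]_m) (A : 'I_n -> 'M[R]_m).
Variable pi : {linear 'rV[R]_n -> 'rV[R]_k}.
Hypothesis symA0 : A0^T = A0.
Hypothesis symA : forall i, (A i)^T = A i.
Hypothesis CE : C = pi @` spectrahedron A0 A.

Let in_lift y : psd (A0 + mxcomb A y) -> C (pi y).
Proof. by move=> h; rewrite CE; exists y. Qed.

(** The homogenization of the lift: [aff c a v] is [a - <c, pi y>]. The coefficient [a] may be
    negative. *)
Definition lift_family (X : 'M[R]_m) (a : R) (v : 'rV[R]_k) : Prop :=
  exists y, [/\ X = a *: A0 + mxcomb A y & v = - pi y].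

Definition recession_family (X : 'M[R]_m) (a : R) (v : 'rV[R]_k) : Prop :=
  a = 0 /\ lift_family X a v.

Lemma mxcomb0 : mxcomb A 0 = 0.
Proof. by rewrite /mxcomb big1 // => i _; rewrite mxE scale0r. Qed.

Lemma lift_family_linear : linear_family lift_family.
Proof.
split; first by exists 0; rewrite scale0r mxcomb0 addr0 linear0 oppr0.
  move=> t X a v Y b w [y [-> ->]] [z [-> ->]]; exists (t *: y + z); split.
    by rewrite mxcombD mxcombZ scalerDr scalerDl scalerA addrACA.
  by rewrite linearP opprD scalerN.
move=> X a v [y [-> _]]; rewrite linearD linearZ /= symA0; congr (_ + _).
exact: mxcomb_sym.
Qed.

Lemma recession_family_linear : linear_family recession_family.
Proof.
have [L0 LD Ls] := lift_family_linear.
split; first by split.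
  by move=> t X a v Y b w [-> hX] [-> hY]; split; [rewrite mulr0 addr0|exact: LD].
by move=> X a v [_]; exact: Ls.
Qed.

(** For [t > 0] rescale to a point of the spectrahedron. For [t = 0] the matrix is a recession
    direction, along which a negative value would make the functional unbounded below on the
    lift. *)
Lemma aff_ge0 c : polar C c -> forall t y, 0 <= t -> psd (t *: A0 + mxcomb A y) ->
  (exists y, psd (A0 + mxcomb A y)) -> 0 <= aff c t (- pi y).
Proof.
move=> /polar_affE pc t y; rewrite le_eqVlt => /orP[/eqP <-|t0] hy [y1 hy1]; last first.
  have h : psd (A0 + mxcomb A (t^-1 *: y)).
    have -> : A0 + mxcomb A (t^-1 *: y) = t^-1 *: (t *: A0 + mxcomb A y).
      by rewrite mxcombZ scalerDr scalerA mulVf ?gt_eqF // scale1r.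
    by apply: psdZ; rewrite ?invr_ge0 ?(ltW t0).
  have := pc _ (in_lift h); rewrite -(pmulr_rge0 _ t0) -affZ mulr1.
  by rewrite linearZ -scalerN scalerA divff ?gt_eqF // scale1r.
rewrite scale0r add0r in hy.
have h l : 0 <= l -> 0 <= aff c 1 (- pi y1) + l * aff c 0 (- pi y).
  move=> l0; have hl : psd (A0 + mxcomb A (l *: y + y1)).
    rewrite mxcombD mxcombZ addrCA; apply: psdD => //; exact: psdZ.
  have := pc _ (in_lift hl); rewrite linearP opprD -scalerN -{1}(add0r 1) affD.
  by have := affZ c l 0 (- pi y); rewrite mulr0 => ->; rewrite addrC.
rewrite leNgt; apply/negP => neg; have p0 := pc _ (in_lift hy1).
(* This multiple of the recession direction would bring the value to -1. *)
have l0 : 0 <= (aff c 1 (- pi y1) + 1) / - aff c 0 (- pi y).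
  by apply: divr_ge0; [exact: addr_ge0 | rewrite oppr_ge0 ltW].
have := h _ l0; rewrite invrN mulrN mulNr divfK ?lt_eqF //.
by rewrite opprD addrA subrr add0r oppr_ge0 leNgt ltr01.
Qed.

Lemma size1D a (v : 'rV[R]_k) b w : size1 (a + b) (v + w) <= size1 a v + size1 b w.
Proof.
rewrite /size1 addrACA lerD ?ler_normD // -big_split ler_sum // => l _.
by rewrite mxE ler_normD.
Qed.

(** If the functional is nonnegative on the psd members with [t < 0] as well, the whole family is
    tight. Otherwise one such member, scaled to [t = -1], has value [- eta < 0]; adding it to nearly
    tight members with [t = 1] gives members with [t = 0] of small relative value. *)
Lemma boundary_tight c : boundary (polar C) c ->
  ((0 < m)%N /\ tight lift_family c) \/ tight recession_family c.
Proof.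
move=> /boundary_polar_approx[pc happ].
have [y1 hy1] : exists y, psd (A0 + mxcomb A y).
  by have [x + _] := happ 1 ltr01; rewrite CE => -[y hy _]; exists y.
have ge0 t y t0 hy := aff_ge0 pc t0 hy (ex_intro _ y1 hy1) : 0 <= aff c t (- pi y).
have app eps : 0 < eps -> exists2 y, psd (A0 + mxcomb A y) &
    aff c 1 (- pi y) < eps * size1 1 (- pi y).
  by move=> /happ[x]; rewrite CE => -[y hy <-] h; exists y.
have [pos|] := pselect (forall X a v, lift_family X a v -> psd X -> 0 <= aff c a v).
  left; split; last first.
    split => // eps /app[y hy lt]; exists (A0 + mxcomb A y), 1, (- pi y); split => //.
    by exists y; rewrite scale1r.
  (* For [m = 0] every matrix is psd, in particular the member with [a = -1] and [v = 0], where the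
     functional is -1. *)
  rewrite lt0n; apply/negP => /eqP m0.
  have LX : lift_family ((-1) *: A0 + mxcomb A 0) (-1) (- pi 0) by exists 0.
  have hX : psd ((-1) *: A0 + mxcomb A 0).
    have -> : (-1) *: A0 + mxcomb A 0 = 0 by apply/matrixP => i; case: (cast_ord m0 i).
    by rewrite psdP trmx0; split => // u; rewrite qf0.
  have := pos _ _ _ LX hX; rewrite linear0 oppr0 /aff big1 ?addr0 => [|l _]; last first.
    by rewrite mxE mulr0.
  by rewrite oppr_ge0 leNgt ltr01.
move=> npos; right.
have [X [t [v [[y [eX ev]] hX neg]]]] : exists X t v,
    [/\ lift_family X t v, psd X & aff c t v < 0].
  apply: contrapT => h; apply: npos => X a v LX hX; rewrite leNgt; apply/negP => neg.
  by apply: h; exists X, a, v.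
rewrite eX in hX; rewrite ev in neg.
have t0 : t < 0 by rewrite ltNge; apply/negP => t0; move: neg; rewrite ltNge ge0.
pose z := (- t)^-1 *: y.
have nt0 : 0 < - t by rewrite oppr_gt0.
have hz : psd (- A0 + mxcomb A z).
  have -> : - A0 + mxcomb A z = (- t)^-1 *: (t *: A0 + mxcomb A y).
    by rewrite mxcombZ scalerDr scalerA invrN mulNr mulVf ?lt_eqF // scaleN1r.
  by apply: psdZ; rewrite ?invr_ge0 ?(ltW nt0).
pose eta := - aff c (-1) (- pi z).
have eta0 : 0 < eta.
  have -> : eta = (- t)^-1 * - aff c t (- pi y).
    rewrite /eta mulrN -affZ linearZ /= -scalerN; congr (- aff _ _ _).
    by rewrite invrN mulNr mulVf // lt_eqF.
  by rewrite mulr_gt0 ?invr_gt0 // oppr_gt0.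
split.
  move=> X' a v' [-> [y' [-> ->]]] hy'.
  by apply: ge0.
move=> eps eps0.
have s0 : 0 < 1 + size1 1 (- pi z) by rewrite ltr_pwDl // size1_ge0.
(* The second bound lets [eta] absorb the size of [z], so the error is relative to the size of the
   sum alone. *)
pose e := Num.min eps (eta / (1 + size1 1 (- pi z))).
have e0 : 0 < e by rewrite lt_min eps0 divr_gt0.
have [y' hy' lt] := app e e0.
exists (mxcomb A (y' + z)), 0, (- pi (y' + z)); split.
- by split=> //; exists (y' + z); rewrite scale0r add0r.
- have -> : mxcomb A (y' + z) = (A0 + mxcomb A y') + (- A0 + mxcomb A z).
    by rewrite mxcombD addrACA subrr add0r.
  exact: psdD.
have -> : aff c 0 (- pi (y' + z)) = aff c 1 (- pi y') - eta.
  by rewrite /eta opprK -affD subrr linearD opprD.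
have es : e * size1 1 (- pi z) <= eta.
  apply: (@le_trans _ _ (e * (1 + size1 1 (- pi z)))).
    by rewrite ler_pM2l // lerDr.
  by rewrite -ler_pdivlMr // ge_min lexx orbT.
have sz : size1 1 (- pi y') <= size1 0 (- pi (y' + z)) + size1 1 (- pi z).
  have -> : size1 1 (- pi y') = size1 (0 + 1) (- pi (y' + z) + pi z).
    by rewrite add0r linearD opprD subrK.
  rewrite (le_trans (size1D _ _ _ _)) // lerD2l.
  by rewrite /size1 lerD2l; under [leRHS]eq_bigr do rewrite mxE normrN.
rewrite ltrBlDr (lt_le_trans lt) // (@le_trans _ _
  (e * size1 0 (- pi (y' + z)) + e * size1 1 (- pi z))) //.
  by rewrite -mulrDr ler_pM2l.
by rewrite lerD // ler_wpM2r ?size1_ge0 // ge_min lexx.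
Qed.

Lemma vanishing_polynomial : exists p : mpoly k R,
  [/\ p != 0, vanishes_on p (boundary (polar C)) & ((msize p).-1 <= 2 ^ (m ^ 2))%N].
Proof.
have [p1 [p10 s1 h1]] := linear_family_eliminable lift_family_linear.
have [p0 [p00 s0 h0]] := linear_family_eliminable recession_family_linear.
case: (posnP m) => [m0|m0].
  (* For [m = 0] two factors of degree up to [elimdeg 0 = 1] could exceed [2 ^ 0]; only the
     recession family occurs here. *)
  exists p0; split => //.
    by move=> c /boundary_tight[[m1 _]|/h0 //]; rewrite m0 in m1.
  by apply: leq_trans (_ : (elimdeg m <= _)%N); [case: (msize p0) s0|rewrite /elimdeg m0].
exists (p1 * p0); split; first exact: mulf_neq0.
  move=> c /boundary_tight[[_ /h1 e]|/h0 e]; rewrite mevalM e ?mul0r ?mulr0 //.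
rewrite msizeM //; have <- : (elimdeg m + elimdeg m = 2 ^ (m ^ 2))%N.
  by rewrite addnn -mul2n -expnS prednK // expn_gt0 m0.
by have := leq_add s1 s0; rewrite addSn addnS; case: (_ + _)%N => [|[|u]].
Qed.

End Lift.

(** * From the degree bound to the rank bound *)

Lemma sdp_lift_degree (R : realType) k (C : set 'rV[R]_k) m : has_sdp_lift C m ->
  (min_vanishing_degree (boundary (polar C)) <= (2 ^ (m ^ 2))%N%:R%:E)%E.
Proof.
move=> [n [A0 [A [pi [sA0 sA CE]]]]].
have sA0' : A0^T = A0 by apply/eqP; rewrite -symmetricmxE.
have sA' i : (A i)^T = A i by apply/eqP; rewrite -symmetricmxE.
have [p [p0 vp pdeg]] := vanishing_polynomial sA0' sA' CE.
apply: (@le_trans _ _ ((msize p).-1%:R)%:E); last by rewrite lee_fin ler_nat.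
by apply: ereal_inf_lbound; exists (msize p).-1 => //; exists p.
Qed.

Lemma log2_exp (R : realType) (n : nat) : log2 ((2 ^ n)%N%:R%:E : \bar R) = n%:R%:E.
Proof.
rewrite /log2 natrX lne_EFin ?exprn_gt0 // lnXn // -EFinM.
by rewrite -(mulr_natl (ln _)) mulfK // gt_eqF // ln_gt0 // ltr1n.
Qed.

Lemma le_log2 (R : realType) (x y : \bar R) : (0 <= x)%E -> (x <= y)%E ->
  (log2 x <= log2 y)%E.
Proof.
move=> x0 xy; rewrite /log2; apply: lee_wpmul2r.
  by rewrite lee_fin invr_ge0 ln_ge0 // ler1n.
by rewrite lee_lne // in_itv /= leey ?x0 ?(le_trans x0 xy).
Qed.

Theorem theorem1 (R : realType) (k : nat) (C : set 'rV[R]_k) :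
  convex_body C ->
  (sqrte (log2 (min_vanishing_degree (boundary (polar C)))) <= psd_rank C)%E.
Proof.
move=> _; apply: le_ereal_inf_tmp => _ [m /sdp_lift_degree dm <-].
have d0 : (0 <= min_vanishing_degree (boundary (polar C)))%E.
  by apply: le_ereal_inf_tmp => _ [d _ <-]; rewrite lee_fin ler0n.
have -> : (m%:R%:E = sqrte ((m ^ 2)%N%:R%:E) :> \bar R)%E.
  by rewrite natrX EFin_expe sqrte_sqr gee0_abs // lee_fin ler0n.
rewrite lee_sqrt ?lee_fin ?ler0n // -log2_exp.
exact: le_log2.
Qed.
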